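(* Let $b$ be a prime power, $s\ge 1$, and let $(\mathbf{x}_n)_{n\ge 0}$ be a generalized Niederreiter sequence in base $b$ (as defined in the context) built from pairwise coprime nonconstant polynomials $p_1,\dots,p_s\in\mathbb{F}_b[x]$ satisfying $\gcd(x,p_i(x))=1$ for $1\le i\le s$. Let $\gamma_1,\dots,\gamma_s\in(0,1)$ with $b$-adic expansions $\gamma_i=\sum_{j\ge1}\gamma_{i,j}b^{-j}$, $\gamma_{i,j}\in\{0,1,\dots,b-1\}$. Then the box $[0,\gamma_1)\times\cdots\times[0,\gamma_s)$ is a bounded remainder set for $(\mathbf{x}_n)_{n\ge0}$ if and only if $$\max_{1\le i\le s}\max\{j\ge1:\gamma_{i,j}\ne0\}<\infty,$$ i.e. if and only if every $\gamma_i$ has a finite $b$-adic expansion.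
   Context: Bounded remainder set: for a sequence $(\mathbf{x}_n)_{n\ge0}$ in $[0,1)^s$ and $S\subseteq[0,1)^s$, put $\Delta(S,N)=\sum_{n=0}^{N-1}(\mathbf{1}_S(\mathbf{x}_n)-\lambda(S))$, where $\lambda$ is Lebesgue measure; $S$ is a bounded remainder set if $\sup_{N\ge1}|\Delta(S,N)|<\infty$. Digital sequences: fix a bijection $\phi:\{0,1,\dots,b-1\}\to\mathbb{F}_b$ with $\phi(0)=0$. Given matrices $C^{(i)}=(c^{(i)}_{j,r})_{j\ge1,r\ge0}$ over $\mathbb{F}_b$, $1\le i\le s$, for $n=\sum_{r\ge0}a_r(n)b^r$ ($a_r(n)\in\{0,\dots,b-1\}$) put $\bar a_r(n)=\phi(a_r(n))$, $y^{(i)}_{n,j}=\sum_{r\ge0}\bar a_r(n)c^{(i)}_{j,r}\in\mathbb{F}_b$, $x^{(i)}_n=\sum_{j\ge1}\phi^{-1}(y^{(i)}_{n,j})b^{-j}$ and $\mathbf{x}_n=(x^{(1)}_n,\dots,x^{(s)}_n)$. Generalized Niederreiter sequence: $p_1,\dots,p_s\in\mathbb{F}_b[x]$ pairwise coprime, $e_i=\deg p_i\ge1$. For each $j\ge1$ and $1\le i\le s$, polynomials $y_{i,j,k}(x)$, $0\le k<e_i$, are given which are linearly independent modulo $p_i(x)$ over $\mathbb{F}_b$. Let $a^{(i)}(j,k,r)\in\mathbb{F}_b$ be the coefficient of $x^{-r-1}$ in the expansion of $y_{i,j,k}(x)/p_i(x)^j$ in the field of formal Laurent series $\mathbb{F}_b((x^{-1}))$.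 For $j\ge1$ write $j-1=Qe_i+k$ with integers $Q\ge0$, $0\le k<e_i$, and set $c^{(i)}_{j,r}=a^{(i)}(Q+1,k,r)$. The generalized Niederreiter sequence is the digital sequence with these generating matrices $C^{(1)},\dots,C^{(s)}$. *)

(* Defs.v *)
From HB Require Import structures.
From mathcomp Require Import all_boot all_order all_algebra.
From mathcomp Require Import all_classical all_reals all_analysis.
From mathcomp Require Import zify.

Set Implicit Arguments.
Unset Strict Implicit.
Unset Printing Implicit Defensive.
Import Order.TTheory GRing.Theory Num.Theory.
Import numFieldNormedType.Exports.
Local Open Scope classical_set_scope.
Local Open Scope ring_scope.

Section cons_measure.
Context {R : realType} (s : nat).
Local Notation RT := (measurableTypeR R).
Variable m : {measure set (s.-tuple RT) -> \bar R}.

Definition tcons (xt : RT * s.-tuple RT) : s.+1.-tuple RT :=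
  [tuple of xt.1 :: xt.2].

Lemma measurable_tcons : measurable_fun setT tcons.
Proof. exact: (@measurable_cons _ _ _ _ fst _ snd). Qed.

Definition cons_measure : set (s.+1.-tuple RT) -> \bar R :=
  pushforward (@lebesgue_measure R \x^ m)%E tcons.

HB.instance Definition _ := Measure.copy cons_measure
  (measure_function_pushforward__canonical__measure_function_Measure
    (@lebesgue_measure R \x^ m)%E measurable_tcons).

End cons_measure.

(* Lebesgue measure on the Borel sets of R^s, as an iterated product measure
   transported to s-tuples; for s = 0 it is the unit mass at the empty tuple. *)
Fixpoint lebesgue_tuple (R : realType) (s : nat) :
    {measure set (s.-tuple (measurableTypeR R)) -> \bar R} :=
  match s with
  | 0%N => \d_([tuple] : 0.-tuple (measurableTypeR R))
  | s'.+1 => cons_measure (lebesgue_tuple R s')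
  end.

Definition box (R : realType) (s : nat) (gamma : 'I_s -> R) :
    set (s.-tuple R) :=
  [set t | forall i, 0 <= tnth t i < gamma i].

Lemma lebesgue_tuple_box (R : realType) (s : nat) (gamma : 'I_s -> R) :
  (forall i, 0 <= gamma i) ->
  measurable (box gamma : set (s.-tuple (measurableTypeR R))) /\
  lebesgue_tuple R s (box gamma) = (\prod_(i < s) gamma i)%:E.
Proof.
elim: s gamma => [|s IH] gamma g0.
  have -> : box gamma = setT by apply/seteqP; split=> // t _ [].
  by split=> //; rewrite big_ord0 /= diracT.
have [mB lB] := IH (fun i => gamma (lift ord0 i)) (fun i => g0 _).
set B := box _ in mB lB.
have tconsE : @tcons R s @^-1` box gamma = `[0, gamma ord0[%classic `*` B.
  apply/seteqP; split=> [[x t] /= h|[x t] [/= hx ht] i].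
    split=> /=; first by have := h ord0; rewrite in_itv.
    by move=> i; have := h (lift ord0 i); rewrite tnthS.
  case: (unliftP ord0 i) => [j ->|->]; first by rewrite tnthS; exact: ht.
  by move: hx; rewrite in_itv.
split; last first.
  rewrite /= /cons_measure /pushforward tconsE product_measure2E //=.
  rewrite lB lebesgue_measure_itv/= lte_fin big_ord_recl EFinM.
  case: ltrP => [_|h]; first by rewrite sube0.
  by have -> : gamma ord0 = 0 by apply/eqP; rewrite eq_le h g0.
have -> : box gamma = \bigcap_(i in [set: 'I_s.+1])
    ((@tnth _ (measurableTypeR R) ^~ i) @^-1` `[0, gamma i[%classic).
  apply/seteqP; split=> t /= h i => [_|]; first by rewrite /= in_itv /=.
  by have := h i I; rewrite /= in_itv.
apply: fin_bigcap_measurable => // i _.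
rewrite -[X in measurable X]setTI; exact: measurable_tnth.
Qed.

Section Laurent.
Variable F : fieldType.

(* An element of F((x^-1)) is encoded by its coefficient function f : int -> F,
   f m being the coefficient of x^m; only finitely many positive powers of x
   occur. *)
Definition is_laurent (f : int -> F) : Prop :=
  exists d : int, forall m : int, d < m -> f m = 0.

Definition laurent_of_poly (q : {poly F}) (m : int) : F :=
  if m is Posz k then q`_k else 0.

(* the product of q and f in F((x^-1)) *)
Definition laurent_polyM (q : {poly F}) (f : int -> F) (m : int) : F :=
  \sum_(i < size q) q`_i * f (m - i%:Z).

Definition is_laurent_quotient (y q : {poly F}) (f : int -> F) : Prop :=
  is_laurent f /\ laurent_polyM q f =1 laurent_of_poly y.

(* y / q in F((x^-1)) *)
Definition laurent_quotient (y q : {poly F}) : int -> F :=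
  xget (fun=> 0) [set f | is_laurent_quotient y q f].

Let quo (y q : {poly F}) (N : nat) : {poly F} := (y * 'X^N) %/ q.

Let coef_quoD (y q : {poly F}) (d N k : nat) : q != 0 ->
  (quo y q (N + d))`_(k + d) = (quo y q N)`_k.
Proof.
move=> q0; elim: d => [|d IH]; first by rewrite !addn0.
rewrite -IH !addnS; move: (N + d)%N (k + d)%N => {IH k d}N k.
rewrite /quo exprSr mulrA {1}(divp_eq (y * 'X^N) q) mulrDl mulrAC.
rewrite divpD mulpK // coefD coefMX /= [X in _ + X]nth_default ?addr0 //.
have : (size ((y * 'X^N) %% q)%R < size q)%N by rewrite ltn_modp.
have : (size (((y * 'X^N) %% q) * 'X)%R <= (size ((y * 'X^N) %% q)%R).+1)%N.
  by rewrite (leq_trans (size_polyMleq _ _)) // size_polyX addn2.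
rewrite size_divp // leq_subLR => h1 h2; apply: leq_trans h1 _.
by rewrite addnS ltnS (leq_trans _ (leq_addr _ _)) // -ltnS prednK // size_poly_gt0.
Qed.

Let series_quo (y q : {poly F}) (m : int) : F :=
  (quo y q (absz m))`_(absz (m + (absz m)%:Z)).

Let series_quoE (y q : {poly F}) (m : int) (N : nat) : q != 0 ->
  ((absz m) <= N)%N -> series_quo y q m = (quo y q N)`_(absz (m + N%:Z)).
Proof.
move=> q0 mN; rewrite /series_quo -(coef_quoD y (N - (absz m)) _ _ q0) subnKC //.
by congr (_`__); lia.
Qed.

Lemma is_laurent_quotientP (y q : {poly F}) : q != 0 ->
  is_laurent_quotient y q (laurent_quotient y q).
Proof.
move=> q0; apply: (@xgetPex _ _ [set f | is_laurent_quotient y q f]).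
exists (series_quo y q); split.
  exists (size y)%:Z => m ym.
  rewrite (series_quoE y (N := (absz m))) // /quo nth_default // size_divp //.
  have : (size (y * 'X^(absz m))%R <= size y + (absz m))%N.
    by rewrite (leq_trans (size_polyMleq _ _)) // size_polyXn addnS.
  move: (size _) ym => a ym h; rewrite leq_subLR; apply: leq_trans h _.
  apply: leq_trans (leq_addl _ _); lia.
move=> m; set N := ((absz m) + size q)%N; rewrite /laurent_polyM.
have lt_q : (size q <= absz (m + N%:Z)%R)%N by rewrite /N; lia.
have E : (q * quo y q N)`_(absz (m + N%:Z)) = (y * 'X^N)`_(absz (m + N%:Z)).
  rewrite [in RHS](divp_eq (y * 'X^N) q) coefD mulrC -/(quo y q N).
  rewrite (_ : ((y * 'X^N) %% q)`_ _ = 0) ?addr0 // nth_default //.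
  by rewrite (leq_trans _ lt_q) // ltnW // ltn_modp.
rewrite coefM coefMXn in E.
transitivity (\sum_(i < size q) q`_i * (quo y q N)`_(absz (m + N%:Z)%R - i)).
  apply: eq_bigr => i _; have iq := ltn_ord i.
  rewrite (series_quoE y (N := N)) //; last by rewrite /N; lia.
  by congr (_ * _`__); rewrite /N; lia.
transitivity (\sum_(i < (absz (m + N%:Z)%R).+1) q`_i * (quo y q N)`_(absz (m + N%:Z)%R - i)).
  rewrite (big_ord_widen _ (fun i => q`_i * (quo y q N)`_(absz (m + N%:Z)%R - i)) (leqW lt_q)).
  rewrite big_mkcond /=; apply: eq_bigr => i _; case: ltnP => // h.
  by rewrite nth_default // mul0r.
rewrite E; case: m @N lt_q {E} => m N lt_q /=; case: ltnP => h //; try (by exfalso; lia).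
by congr (_`__); lia.
Qed.

Lemma laurent_quotient_uniq (y q : {poly F}) (f g : int -> F) : q != 0 ->
  is_laurent_quotient y q f -> is_laurent_quotient y q g -> f =1 g.
Proof.
move=> q0 [[df hf] ef] [[dg hg] eg].
have main : forall k : nat, forall m : int, (Num.max df dg) - k%:Z < m -> f m = g m.
  elim=> [|k IH] m hm.
    rewrite hf ?hg //; lia.
  have [h|h] := ltP (Num.max df dg - k%:Z) m; first exact: IH.
  have := ef (m + (size q).-1%:Z); rewrite -eg /laurent_polyM.
  have sq : (0 < size q)%N by rewrite size_poly_gt0.
  move: sq (lead_coef_eq0 q); rewrite lead_coefE (negbTE q0).
  case: (size q) => // n _ /= /negbT qn0.
  rewrite !big_ord_recr /= (_ : m + n%:Z - n%:Z = m); last by lia.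
  have -> : \sum_(i < n) q`_i * f (m + n%:Z - i%:Z) =
            \sum_(i < n) q`_i * g (m + n%:Z - i%:Z).
    apply: eq_bigr => i _; rewrite IH //; have := ltn_ord i; lia.
  by move/addrI/(mulfI qn0).
move=> m; apply: (main (absz (Num.max df dg)%R + (absz m)).+1); lia.
Qed.

End Laurent.

Definition badic_sum (R : realType) (b : nat) (d : nat -> nat) : R :=
  limn (fun m : nat => \sum_(1 <= j < m.+1) ((d j)%:R / b%:R ^+ j : R)).

Section DigitalSequence.
Variables (R : realType) (F : finFieldType).
Variables (phi : 'I_#|F| -> F) (phiV : F -> 'I_#|F|).

Lemma card_field_gt0 : (0 < #|F|)%N.
Proof. by apply/card_gt0P; exists 0. Qed.

Definition digit (n r : nat) : 'I_#|F| :=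
  Ordinal (ltn_pmod (n %/ #|F| ^ r) card_field_gt0).

(* The sum over all r >= 0 stops at r < n: digit n r = 0 as soon as
   n < #|F| ^ r, in particular for r >= n, and phi 0 = 0. *)
Definition output_digit (C : nat -> nat -> F) (n j : nat) : F :=
  \sum_(r < n) phi (digit n r) * C j r.

Definition digital_coord (C : nat -> nat -> F) (n : nat) : R :=
  badic_sum R #|F| (fun j => phiV (output_digit C n j)).

Definition digital_sequence (s : nat) (C : 'I_s -> nat -> nat -> F) (n : nat) :
    s.-tuple R :=
  [tuple digital_coord (C i) n | i < s].

End DigitalSequence.

Section Niederreiter.
Variable F : finFieldType.

Definition deg (p : {poly F}) : nat := (size p).-1.

Definition lin_indep_mod (p : {poly F}) (v : nat -> {poly F}) : Prop :=
  forall c : 'I_(deg p) -> F,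
    p %| \sum_(k < deg p) c k *: v k -> forall k, c k = 0.

(* coefficient of x^(-r-1) in y_{j,k} / p^j *)
Definition niederreiter_coef (p : {poly F}) (y : nat -> nat -> {poly F})
    (j k r : nat) : F :=
  laurent_quotient (y j k) (p ^+ j) (- r.+1%:Z).

(* rows are indexed by j >= 1; row 0 is never used *)
Definition niederreiter_matrix (p : {poly F}) (y : nat -> nat -> {poly F})
    (j r : nat) : F :=
  niederreiter_coef p y (j.-1 %/ deg p).+1 (j.-1 %% deg p) r.

Definition niederreiter_sequence (R : realType) (phi : 'I_#|F| -> F)
    (phiV : F -> 'I_#|F|) (s : nat) (p : 'I_s -> {poly F})
    (y : 'I_s -> nat -> nat -> {poly F}) : nat -> s.-tuple R :=
  digital_sequence R phi phiV (fun i => niederreiter_matrix (p i) (y i)).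

End Niederreiter.

Definition discrepancy (R : realType) (s : nat) (x : nat -> s.-tuple R)
    (S : set (s.-tuple R)) (N : nat) : R :=
  \sum_(n < N) (\1_S (x n) - fine (lebesgue_tuple R s S)).

Definition bounded_remainder_set (R : realType) (s : nat)
    (x : nat -> s.-tuple R) (S : set (s.-tuple R)) : Prop :=
  has_ubound [set `|discrepancy x S N| | N in [set N | (1 <= N)%N]].

(* d 1, d 2, ... is the b-adic digit sequence of g, with the usual normalisation
   that not all digits from some point on equal b - 1 (so that it is unique) *)
Definition badic_expansion (R : realType) (b : nat) (g : R) (d : nat -> nat) :
    Prop :=
  [/\ forall j, (1 <= j)%N -> (d j < b)%N,
      g = badic_sum R b d &
      forall m, exists2 j, (m <= j)%N & d j <> b.-1].

Definition has_finite_badic_expansion (R : realType) (b : nat) (g : R) : Prop :=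
  exists (m : nat) (d : nat -> nat),
    (forall j, (1 <= j)%N -> (d j < b)%N) /\
    g = \sum_(1 <= j < m.+1) ((d j)%:R / b%:R ^+ j).

(* max_i max {j >= 1 : d_{i,j} <> 0}, infinite if one of the sets is unbounded *)
Definition max_nonzero_digit (R : realType) (s : nat) (d : 'I_s -> nat -> nat) :
    \bar R :=
  \big[maxe/-oo%E]_(i < s)
    ereal_sup [set j%:R%:E | j in [set j | (1 <= j)%N && (d i j != 0%N)]].

(* Main.v *)
(* Write A(n) for the polynomial whose coefficients are the digits of n.  The
   first e_i q digits of the i-th coordinate of x_n determine, and are determined
   by, A(n) mod p_i^q.  Since x is prime to every p_i, the Chinese remainder
   theorem shows that x^M A(k) + U, with k < b^(sm), takes every pattern of first m
   digits in all coordinates exactly once.  If every gamma_i has a finite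
   expansion, the box is, up to finitely many n, a union of such patterns, and
   every block of b^(sm) consecutive indices has discrepancy zero.
   Conversely suppose that the digits of gamma_i0 do not terminate, and that the
   discrepancy is bounded.  For infinitely many J the digits J and J+1 of gamma_i0
   are neither both 0 nor both b-1.  Each such J yields an F-linear form l on
   polynomials that depends on the first J digits of coordinate i0 only and whose
   first nonzero value on the powers of x is at x^M with |M - J| <= e_i0.  Put
   N = sum_t b^(M_t) for a sparse family of such forms l_t.  The counting function
   of the box over the N indices following k b^Mtop, viewed as a function of k,
   then has a correlation bounded away from zero with a bounded function of
   l_t(x^Mtop A(k)), for every t.  These test functions are pairwise orthogonal,
   so boundedness contradicts Bessel's inequality once there are enough levels. *)
Require Import Defs.
From HB Require Import structures.
From mathcomp Require Import all_boot all_order all_algebra.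
From mathcomp Require Import all_classical all_reals all_analysis.
From mathcomp Require Import zify ring lra.

Set Implicit Arguments.
Unset Strict Implicit.
Unset Printing Implicit Defensive.
Import Order.TTheory GRing.Theory Num.Theory.
Import numFieldNormedType.Exports.
Local Open Scope classical_set_scope.
Local Open Scope ring_scope.

(** * Residues in F((1/x)) and the generating matrices *)

Section Residue.
Variable F : fieldType.
Implicit Types (P q w z A : {poly F}) (f : int -> F).

Lemma laurent_of_polyM P q :
  laurent_polyM P (laurent_of_poly q) =1 laurent_of_poly (P * q).
Proof.
move=> [m|m]; last first.
  rewrite /laurent_polyM big1 // => i _.
  by rewrite (_ : Negz m - i%:Z = Negz (m + i)) ?mulr0 //; lia.
rewrite /laurent_polyM /= coefM.
pose G i := P`_i * laurent_of_poly q (m%:Z - i%:Z).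
transitivity (\sum_(i < size P + m.+1) G i).
  rewrite (big_ord_widen _ G (leq_addr m.+1 (size P))) [LHS]big_mkcond /=.
  by apply: eq_bigr => i _; case: ltnP => // h; rewrite /G nth_default ?mul0r.
transitivity (\sum_(i < m.+1) G i); last first.
  apply: eq_bigr => i _; rewrite /G (_ : m%:Z - i%:Z = (m - i)%N :> int) //.
  by rewrite subzn // -ltnS.
rewrite (big_ord_widen _ G (leq_addl (size P) m.+1)) [RHS]big_mkcond /=.
apply: eq_bigr => i _; case: ltnP => // h; rewrite /G.
by case E : (m%:Z - i%:Z) => [k|k] /=; [lia | rewrite mulr0].
Qed.

Lemma laurent_quotientE w P f :
  P != 0 -> is_laurent_quotient w P f -> laurent_quotient w P =1 f.
Proof. by move=> P0; apply: laurent_quotient_uniq => //; exact: is_laurent_quotientP. Qed.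

Lemma laurent_quotientMXn z P (r : nat) (m : int) : P != 0 ->
  laurent_quotient (z * 'X^r) P m = laurent_quotient z P (m - r%:Z).
Proof.
move=> P0; have [[d hd] e] := is_laurent_quotientP z P0.
move: m; apply: laurent_quotientE => //; split.
  by exists (d + r%:Z) => m hm; apply: hd; lia.
move=> m; transitivity (laurent_of_poly z (m - r%:Z)).
  rewrite -e; apply: eq_bigr => i _; congr (_ * laurent_quotient _ _ _); lia.
case: m => [m|m] /=; last by rewrite (_ : Negz m - r%:Z = Negz (m + r)) //; lia.
rewrite coefMXn; case: ltnP => h; last by rewrite subzn.
by rewrite (_ : m%:Z - r%:Z = Negz (r - m).-1) //; lia.
Qed.

(** The coefficient of 1/x in w/P. Multiplying by x^r shifts coefficients, so every entry of the
    generating matrices is such a residue. *)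
Definition residue P w : F := laurent_quotient w P (- 1%:Z).

(** Only the fractional part (w mod P)/P contributes to the term in 1/x, and comparing coefficients
    at x^(deg P - 1) in P f = w mod P gives its value. Residues thus become coefficients of
    remainders. *)
Lemma residueE P w : P != 0 ->
  residue P w = (w %% P)`_(size P).-2 / lead_coef P.
Proof.
move=> P0; have [[d hd] e] := is_laurent_quotientP (w %% P) P0.
set f := laurent_quotient (w %% P) P in hd e.
have sP : (0 < size P)%N by rewrite size_poly_gt0.
have sR : (size (w %% P)%R < size P)%N by rewrite ltn_modp.
have lP : P`_(size P).-1 != 0 by rewrite -lead_coefE lead_coef_eq0.
have fw : residue P w = f (- 1%:Z).
  rewrite /residue (@laurent_quotientE _ _ (fun m => f m + laurent_of_poly (w %/ P) m)) //=.
    by rewrite addr0.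
  split.
    exists (Num.max d (size (w %/ P))%:Z) => m hm; rewrite hd; last by lia.
    case: m hm => [m|m] hm /=; last by rewrite add0r.
    rewrite add0r nth_default //; move: hm; rewrite gt_max => /andP[_].
    by rewrite ltz_nat; exact: ltnW.
  move=> m; rewrite /laurent_polyM; under eq_bigr do rewrite mulrDr.
  rewrite big_split /= -/(laurent_polyM P f m) e -/(laurent_polyM _ _ _).
  rewrite laurent_of_polyM {3}(divp_eq w P) addrC mulrC.
  by case: m => m /=; rewrite ?coefD ?addr0.
(* the equation P f = w mod P at the exponent m + deg P *)
have top (m : int) : (forall m' : int, m < m' -> f m' = 0) ->
    lead_coef P * f m = laurent_of_poly (w %% P) (m + (size P).-1%:Z).
  move=> hm; rewrite -e /laurent_polyM lead_coefE.
  case: (size P) sP => // n _; rewrite big_ord_recr /= big1 ?add0r ?addrK // => i _.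
  by rewrite hm ?mulr0 //; have := ltn_ord i; lia.
(* Descending from the bound [d]: a nonzero top coefficient of [f] at m >= 0 would give w mod P a
   term of degree at least deg P. *)
have f0 (k : nat) (m : int) : 0 <= m -> d - k%:Z < m -> f m = 0.
  elim: k m => [|k IH] m m0 hm; first by apply: hd; lia.
  apply: (mulfI lP); rewrite -lead_coefE mulr0 top; last by move=> m' h; apply: IH; lia.
  case: m m0 {hm} => // m _; rewrite -PoszD /= nth_default //.
  by move: sR; set a := size (w %% P); set b := size P; lia.
rewrite fw; apply: (mulfI lP); rewrite -lead_coefE top; last first.
  by move=> m' h; apply: (@f0 (absz d).+1); lia.
rewrite mulrCA divff ?mulr1 -?lead_coefE // ?lead_coef_eq0 //.
case E : (- 1%:Z + _) => [k|k] /=; first by congr (_`__); move: E; set b := size P; lia.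
by rewrite nth_default //; move: sR E; set a := size (w %% P); set b := size P; lia.
Qed.

Lemma laurent_coef_residue z P r : P != 0 ->
  laurent_quotient z P (- r.+1%:Z) = residue P ('X^r * z).
Proof.
by move=> P0; rewrite /residue mulrC laurent_quotientMXn //; congr laurent_quotient; lia.
Qed.

Lemma residueD P w1 w2 : P != 0 ->
  residue P (w1 + w2) = residue P w1 + residue P w2.
Proof. by move=> P0; rewrite !residueE // modpD coefD mulrDl. Qed.

Lemma residueZ P a w : P != 0 -> residue P (a *: w) = a * residue P w.
Proof. by move=> P0; rewrite !residueE // modpZl coefZ mulrA. Qed.

Lemma residue0 P : P != 0 -> residue P 0 = 0.
Proof. by move=> P0; rewrite residueE // mod0p coef0 mul0r. Qed.

Lemma residue1 w : residue 1 w = 0.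
Proof. by rewrite residueE ?oner_neq0 // modp1 coef0 mul0r. Qed.

Lemma residue_sum P (I : finType) (h : I -> {poly F}) : P != 0 ->
  residue P (\sum_i h i) = \sum_i residue P (h i).
Proof.
move=> P0; apply: (big_morph (residue P)); last exact: residue0.
by move=> x y; exact: residueD.
Qed.

(** Cancellation of q in qw/(qP). On remainders it reads (qw) mod (qP) = q (w mod P), and the
    leading coefficient of q drops out. *)
Lemma residueMl q P w : q != 0 -> P != 0 ->
  residue (q * P) (q * w) = residue P w.
Proof.
move=> q0 P0; rewrite !residueE ?mulf_neq0 //.
have sR : (size (w %% P)%R < size P)%N by rewrite ltn_modp.
have -> : (q * w) %% (q * P) = q * (w %% P).
  rewrite {1}(divp_eq w P) mulrDr mulrCA modpD modp_mull add0r.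
  rewrite modp_small //; have [->|R0] := eqVneq (w %% P) 0.
    by rewrite mulr0 size_poly0 size_poly_gt0 mulf_neq0.
  rewrite !size_mul //; have : (0 < size q)%N by rewrite size_poly_gt0.
  by move: sR; set a := size (w %% P); set b := size P; set c := size q; lia.
have -> : (q * (w %% P))`_(size (q * P)).-2 = lead_coef q * (w %% P)`_(size P).-2.
  have sq : (0 < size q)%N by rewrite size_poly_gt0.
  have sP : (0 < size P)%N by rewrite size_poly_gt0.
  rewrite size_mul // lead_coefE.
  case: (posnP (size (w %% P))) => [|Rp].
    by move/eqP; rewrite size_poly_eq0 => /eqP ->; rewrite mulr0 !coef0 mulr0.
  move: sq sP sR Rp; set a := size (w %% P); set b := size P; set c := size q.
  move=> sq sP sR Rp; have hc : (c.-1 < (c + b).-1.-2.+1)%N by lia.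
  rewrite coefM (bigD1 (Ordinal hc)) //= big1 ?addr0; first by congr (_ * _`__); lia.
  move=> i; rewrite -val_eqE /= => ni.
  have [hi|hi] := leqP c i; first by rewrite nth_default ?mul0r.
  by rewrite [X in _ * X]nth_default ?mulr0 // -/a; lia.
by rewrite lead_coefM invfM mulrACA divff ?lead_coef_eq0 // mul1r.
Qed.

(** Nondegeneracy of the residue pairing on F[x]/(P): if w mod P is nonzero, a suitable power of x
    moves its leading term to degree deg P - 1, where the residue reads it. *)
Lemma residue_dvdp P w : (1 < size P)%N ->
  (forall z, residue P (w * z) = 0) -> P %| w.
Proof.
move=> P1 h; have P0 : P != 0 by rewrite -size_poly_gt0; lia.
rewrite -[_ %| _]/(w %% P == 0); apply: contraT => R0.
have sR : (size (w %% P)%R < size P)%N by rewrite ltn_modp.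
have sR0 : (0 < size (w %% P)%R)%N by rewrite size_poly_gt0.
have := h ('X^((size P).-1 - size (w %% P))); rewrite residueE // [w * _]mulrC -modp_mul.
have e1 : size ('X^((size P).-1 - size (w %% P)) * (w %% P)) = (size P).-1.
  rewrite mulrC size_mulXn //; move: sR; set a := size (w %% P); set b := size P; lia.
rewrite modp_small ?e1 ?prednK ?size_poly_gt0 //.
have := lead_coefM 'X^((size P).-1 - size (w %% P)) (w %% P).
rewrite lead_coefXn mul1r [in LHS]lead_coefE e1 => -> /eqP.
by rewrite mulf_eq0 invr_eq0 !lead_coef_eq0 (negbTE R0) (negbTE P0).
Qed.

End Residue.

(** * The rows of the generating matrices as linear forms *)

Section Rows.
Variables (F : finFieldType) (p : {poly F}) (y : nat -> nat -> {poly F}).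
Hypothesis p_nonconst : (1 <= deg p)%N.
Hypothesis y_indep : forall j, (1 <= j)%N -> lin_indep_mod p (y j).
Implicit Types (A z : {poly F}).

(** Row j of the generating matrix, extended linearly from powers of x to all polynomials; at the
    polynomial of the digits of n it gives digit j of the n-th point, before [phiV] is applied. *)
Definition row_form (j : nat) A : F :=
  residue (p ^+ (j.-1 %/ deg p).+1)
    (A * y (j.-1 %/ deg p).+1 (j.-1 %% deg p)%N).

Lemma nonconst_neq0 : p != 0.
Proof. by apply: contraTneq p_nonconst => ->; rewrite /deg size_poly0. Qed.

Let pX_neq0 q : p ^+ q != 0.
Proof. by rewrite expf_neq0 // nonconst_neq0. Qed.

Lemma size_deg : size p = (deg p).+1.
Proof. by rewrite prednK // size_poly_gt0 nonconst_neq0. Qed.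

Lemma size_exp_deg q : size (p ^+ q) = (q * deg p).+1.
Proof. by rewrite mulnC -size_exp prednK // size_poly_gt0. Qed.

Lemma niederreiter_matrixE j r :
  niederreiter_matrix p y j r = row_form j 'X^r.
Proof. by rewrite /niederreiter_matrix /niederreiter_coef laurent_coef_residue. Qed.

Lemma row_formD j A B : row_form j (A + B) = row_form j A + row_form j B.
Proof. by rewrite /row_form mulrDl residueD. Qed.

Lemma row_formZ j a A : row_form j (a *: A) = a * row_form j A.
Proof. by rewrite /row_form -scalerAl residueZ. Qed.

Lemma row_form0 j : row_form j 0 = 0.
Proof. by rewrite /row_form mul0r residue0. Qed.

Lemma row_form_sum j (I : finType) (h : I -> {poly F}) :
  row_form j (\sum_i h i) = \sum_i row_form j (h i).
Proof. by apply: (big_morph _ (row_formD j)); exact: row_form0. Qed.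

(** As many polynomials as deg p, independent modulo p, form a basis of F[x]/(p): the square matrix
    [Y] of their remainders is invertible. *)
Lemma lin_indep_mod_span (v : nat -> {poly F}) z : lin_indep_mod p v ->
  exists c : nat -> F, exists z', z = \sum_(k < deg p) c k *: v k + p * z'.
Proof.
move=> hv; set e := deg p.
have sz w : (size (w %% p)%R <= e)%N.
  by rewrite -ltnS -size_deg ltn_modp nonconst_neq0.
pose Y : 'M[F]_e := \matrix_(k < e) poly_rV (v k %% p).
have YE (c : 'rV[F]_e) : c *m Y = poly_rV ((\sum_(k < e) c 0 k *: v k) %% p).
  rewrite mulmx_sum_row (big_morph _ (modpD p) (mod0p p)) linear_sum.
  by apply: eq_bigr => k _; rewrite rowK modpZl linearZ.
have Yu : Y \in unitmx.
  rewrite -row_free_unit; apply/inj_row_free => c; rewrite YE => /(congr1 rVpoly).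
  rewrite poly_rV_K // linear0 => /eqP hc; apply/rowP => k; rewrite mxE.
  exact: (hv (c 0) hc k).
pose c := poly_rV (z %% p) *m invmx Y.
have : c *m Y = poly_rV (z %% p) by rewrite mulmxKV.
rewrite YE => /(congr1 rVpoly); rewrite !poly_rV_K // => hz.
exists (fun k => oapp (c 0) 0 (insub k)).
exists (z %/ p - (\sum_(k < e) c 0 k *: v k) %/ p).
under eq_bigr do rewrite valK /=.
rewrite [LHS](divp_eq z p) -hz; set S := \sum_(k < e) _.
by rewrite [X in _ = X + _](divp_eq S p); ring.
Qed.

(** Induction on q. Expand z modulo p in the basis of level q+1: the basis part gives the next deg p
    rows, and the part divisible by p cancels one factor p, leaving a residue over p^q. *)
Lemma residue_span q z : exists w : nat -> F, forall A,
  residue (p ^+ q) (A * z) = \sum_(j < q * deg p) w j * row_form j.+1 A.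
Proof.
set e := deg p; elim: q z => [|q IH] z.
  by exists (fun=> 0) => A; rewrite expr0 residue1 big_ord0.
have [c [z' ->]] := lin_indep_mod_span z (y_indep (isT : 0 < q.+1)%N).
have [w hw] := IH z'.
exists (fun j => if (j < q * e)%N then w j else c (j - q * e)%N) => A.
rewrite mulSnr big_split_ord /= mulrDr residueD // [LHS]addrC; congr (_ + _).
  rewrite exprS mulrCA residueMl ?nonconst_neq0 // hw.
  by apply: eq_bigr => j _; rewrite ltn_ord.
rewrite mulr_sumr residue_sum //; apply: eq_bigr => k _.
rewrite -ltn_subRL subnn /= addKn -scalerAr residueZ // /row_form /=.
have e0 : (0 < e)%N by [].
by rewrite divnMDl // divn_small // addn0 modnMDl modn_small.
Qed.

(** These rows span all forms sending A to the residue of A z over p^q, so nondegeneracy of the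
    pairing applies. *)
Lemma row_form_dvdp q A :
  (forall j, (j < q * deg p)%N -> row_form j.+1 A = 0) -> p ^+ q %| A.
Proof.
case: q => [|q] h; first by rewrite expr0 dvd1p.
apply: residue_dvdp => [|z].
  by rewrite size_exp_deg ltnS muln_gt0 p_nonconst.
have [w ->] := residue_span q.+1 z.
by rewrite big1 // => j _; rewrite h ?mulr0.
Qed.

(* Adding lower rows to row J replaces y_J by its remainder mod p, a nonzero
   polynomial of degree < deg p; this fixes the order of vanishing at x^-1. *)
Lemma level_form J : (1 <= J)%N -> exists (M : nat) (w : nat -> F),
  let l A := row_form J A + \sum_(j < J.-1) w j * row_form j.+1 A in
  [/\ forall A, (size A <= M)%N -> l A = 0, l 'X^M != 0,
      (J <= M + deg p)%N & (M < J + deg p)%N].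
Proof.
move=> J1; set e := deg p; set Q := (J.-1 %/ e)%N; set k := (J.-1 %% e)%N.
have e0 : (0 < e)%N by [].
have ke : (k < e)%N by rewrite ltn_mod.
have JE : J = (Q * e + k).+1 by rewrite -divn_eq prednK.
set v := y Q.+1 k; pose zeta : {poly F} := v %% p.
have zeta0 : zeta != 0.
  apply/negP => pv; pose c (i : 'I_e) : F := (i == k :> nat)%:R.
  have : p %| \sum_(i < e) c i *: y Q.+1 i.
    rewrite (bigD1 (Ordinal ke)) //= /c eqxx scale1r big1 ?addr0 // => i.
    by rewrite -val_eqE /= => /negbTE ->; rewrite scale0r.
  move/(y_indep (isT : 0 < Q.+1)%N)/(_ (Ordinal ke)) => /eqP.
  by rewrite /c eqxx oner_eq0.
have szeta : (0 < size zeta <= e)%N.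
  by rewrite size_poly_gt0 zeta0 -ltnS -size_deg ltn_modp nonconst_neq0.
have [w hw] := residue_span Q (v %/ p).
(* In v = p (v/p) + [zeta] the first summand contributes a form over p^Q, a combination of the first
   Q e rows; subtracting it leaves the residue of A [zeta]. *)
pose w' j := if (j < Q * e)%N then - w j else 0.
have lE A : row_form J A + \sum_(j < J.-1) w' j * row_form j.+1 A =
            residue (p ^+ Q.+1) (A * zeta).
  rewrite {1}/row_form -/e -/Q -/k -/v {1}(divp_eq v p) mulrDr residueD //.
  rewrite -/zeta exprS mulrA [_ * p]mulrC residueMl ?nonconst_neq0 // hw.
  suff -> : \sum_(j < J.-1) w' j * row_form j.+1 A =
            - \sum_(j < Q * e) w j * row_form j.+1 A by rewrite addrAC subrr add0r.
  rewrite JE /= big_split_ord /= [X in _ + X]big1 => [|i _].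
    by rewrite addr0 -sumrN; apply: eq_bigr => j _; rewrite /w' /= ltn_ord mulNr.
  by rewrite /w' -ltn_subRL subnn /= mul0r.
have sP := size_exp_deg Q.+1.
(* The residue over p^(Q+1) reads degree (Q+1)e - 1. The product A [zeta] stays below it while size
   A <= M, and x^M [zeta] reaches it exactly. *)
exists (Q.+1 * e - size zeta)%N, w'; split.
- move=> A sA; rewrite lE residueE //; have [->|A0] := eqVneq A 0.
    by rewrite mul0r mod0p coef0 mul0r.
  have s1 : (size (A * zeta)%R < (Q.+1 * e))%N.
    by rewrite size_mul //; move: szeta sA; set a := size zeta; set b := size A; rewrite mulSn; lia.
  rewrite modp_small ?sP; last exact: ltnW.
  by rewrite nth_default ?mul0r //; move: s1; set a := size _; set n := (_ * _)%N; lia.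
- rewrite lE residueE // ['X^_ * _]mulrC.
  have s1 : size (zeta * 'X^(Q.+1 * e - size zeta)) = (Q.+1 * e)%N.
    by rewrite size_mulXn //; move: szeta; set a := size zeta; rewrite mulSn; lia.
  have := lead_coefM zeta 'X^(Q.+1 * e - size zeta).
  rewrite lead_coefXn mulr1 [in LHS]lead_coefE s1 => lc.
  rewrite modp_small ?s1 ?sP // lc.
  by rewrite mulf_neq0 ?invr_eq0 ?lead_coef_eq0.
- by move: szeta; set a := size zeta; rewrite mulSn JE; lia.
- by move: szeta; set a := size zeta; rewrite mulSn JE; lia.
Qed.

End Rows.

(** * Digits, index polynomials and equidistribution *)

(** The integer with base b digits d 1, ..., d m, most significant first: b^m times the expansion
    truncated after m places. *)
Fixpoint digits_num (b : nat) (d : nat -> nat) (m : nat) : nat :=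
  if m is m'.+1 then (digits_num b d m' * b + d m)%N else 0%N.

Section DigitsNum.
Local Open Scope nat_scope.
Variables (b : nat) (d : nat -> nat).
Hypothesis d_lt : forall j, 1 <= j -> d j < b.

Let b_gt0 : 0 < b.
Proof. exact: leq_ltn_trans (d_lt (leqnn 1)). Qed.

Lemma digits_num_lt m : digits_num b d m < b ^ m.
Proof.
elim: m => // m IH /=; rewrite expnSr.
have := d_lt (isT : 1 <= m.+1); move: IH; set x := digits_num _ _ _; nia.
Qed.

Lemma digits_num_div m r : r <= m -> digits_num b d m %/ b ^ r = digits_num b d (m - r).
Proof.
elim: r m => [|r IH] [|m] //= rm; first by rewrite divn1.
by rewrite expnS divnMA divnMDl // (divn_small (d_lt _)) // addn0 IH.
Qed.

Lemma digits_num_digit m j : 1 <= j <= m ->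
  (digits_num b d m %/ b ^ (m - j)) %% b = d j.
Proof.
case/andP=> j1 jm; rewrite digits_num_div ?leq_subr // subKn //.
by case: j j1 {jm} => // j _ /=; rewrite modnMDl modn_small ?d_lt.
Qed.

Lemma digits_num_ge m j : 1 <= j <= m -> 0 < d j -> b ^ (m - j) <= digits_num b d m.
Proof.
case/andP=> j1 jm dj; rewrite (divn_eq (digits_num b d m) (b ^ (m - j))).
apply: leq_trans (leq_addr _ _); rewrite leq_pmull //.
rewrite digits_num_div ?leq_subr // subKn //.
by case: j j1 dj {jm} => // j _ dj /=; rewrite addn_gt0 dj orbT.
Qed.

End DigitsNum.

Section SumBlocks.
Variables (V : nmodType).

Lemma sum_mul_blocks (c B : nat) (h : nat -> V) :
  \sum_(n < c * B) h n = \sum_(i < c) \sum_(n < B) h (i * B + n)%N.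
Proof.
elim: c => [|c IH]; first by rewrite mul0n !big_ord0.
by rewrite mulSnr big_split_ord big_ord_recr IH.
Qed.

End SumBlocks.

(** * Index polynomials and sums over blocks of indices *)

Section IndexPoly.
Variables (F : finFieldType) (phi : 'I_#|F| -> F) (phiV : F -> 'I_#|F|).
Hypothesis phiK : cancel phi phiV.
Hypothesis phiVK : cancel phiV phi.
Hypothesis phi0 : forall a : 'I_#|F|, val a = 0%N -> phi a = 0.
Local Notation b := #|F|.

Let b_gt0 : (0 < b)%N := card_field_gt0 F.

Lemma card_field_gt1 : (1 < b)%N.
Proof. exact: card_finNzRing_gt1. Qed.

Let b_gt1 := card_field_gt1.

(** The polynomial A(n). Stopping before degree n loses nothing, as n < b^n. *)
Definition index_poly (n : nat) : {poly F} :=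
  \poly_(r < n) phi (digit F n r).

Lemma coef_index_poly n r : (index_poly n)`_r = phi (digit F n r).
Proof.
rewrite coef_poly; case: ltnP => // nr; rewrite phi0 //=.
by rewrite divn_small ?mod0n // (leq_ltn_trans nr) // ltn_expl.
Qed.

Lemma size_index_poly M n : (n < b ^ M)%N -> (size (index_poly n) <= M)%N.
Proof.
move=> nM; apply/leq_sizeP => r Mr; rewrite coef_index_poly phi0 //=.
by rewrite divn_small ?mod0n // (leq_trans nM) // leq_exp2l.
Qed.

(** There is no carry: k fills the places from M on, n those below M. *)
Lemma index_poly_block M k n : (n < b ^ M)%N ->
  index_poly (k * b ^ M + n) = 'X^M * index_poly k + index_poly n.
Proof.
move=> nM; apply/polyP => r; rewrite coefD coefXnM !coef_index_poly.
case: ltnP => Mr.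
  rewrite add0r; congr phi; apply: val_inj => /=.
  have -> : (b ^ M = b ^ (M - r.+1) * b * b ^ r)%N.
    by rewrite -expnSr -expnD; congr (_ ^ _)%N; lia.
  by rewrite !mulnA divnMDl ?expn_gt0 ?b_gt0 // modnMDl.
rewrite [phi (digit F n r)]phi0 /=; last first.
  by rewrite divn_small ?mod0n // (leq_trans nM) // leq_exp2l.
rewrite addr0; congr phi; apply: val_inj => /=; congr (_ %% _)%N.
rewrite -{1}(subnKC Mr) expnD divnMA divnMDl ?expn_gt0 ?b_gt0 //.
by rewrite (divn_small nM) addn0.
Qed.

Lemma index_poly_inj : injective index_poly.
Proof.
move=> n n' e; have {e} : forall r, digit F n r = digit F n' r.
  by move=> r; apply: (can_inj phiK); rewrite -!coef_index_poly e.
have [N nN] : exists N, (n + n' < b ^ N)%N.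
  by exists (n + n')%N; rewrite ltn_expl.
elim: N n n' nN => [|N IH] n n' nN e.
  by move: nN; rewrite expn0; case: n {e} => //; case: n'.
rewrite (divn_eq n b) (divn_eq n' b); have /(congr1 val)/= := e 0%N.
rewrite expn0 !divn1 => ->; rewrite (IH (n %/ b) (n' %/ b))%N //.
  rewrite -(ltn_pmul2r b_gt0) mulnDl -expnSr (leq_ltn_trans _ nN) //.
  by rewrite leq_add // leq_trunc_div.
by move=> r; apply: val_inj => /=; have /(congr1 val)/= := e r.+1; rewrite expnS !divnMA.
Qed.

Lemma index_poly_digit (c : 'I_b) : index_poly c = (phi c)%:P.
Proof.
apply/polyP => r; rewrite coef_index_poly coefC.
case: r => [|r] /=; last first.
  by rewrite phi0 //= divn_small ?mod0n // (leq_trans (ltn_ord c)) // -{1}(expn1 b) leq_exp2l.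
by congr phi; apply: val_inj; rewrite /= expn0 divn1 modn_small.
Qed.

Lemma sum_index_polyS (V : nmodType) (H : {poly F} -> V) M :
  \sum_(n < b ^ M.+1) H (index_poly n) =
  \sum_(c : F) \sum_(n < b ^ M) H (c *: 'X^M + index_poly n).
Proof.
rewrite expnS (sum_mul_blocks b (b ^ M) (fun n => H (index_poly n))).
rewrite [RHS](reindex phi); last by exists phiV => x _; [exact: phiK|exact: phiVK].
apply: eq_bigr => c _; apply: eq_bigr => n _.
by rewrite index_poly_block // index_poly_digit mulrC mul_polyC.
Qed.

Section Level.
Variables (V : nmodType) (l : {poly F} -> F) (g : F -> V) (M : nat).
Hypothesis lD : forall A B : {poly F}, l (A + B) = l A + l B.
Hypothesis lZ : forall a (A : {poly F}), l (a *: A) = a * l A.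
Hypothesis l_small : forall A : {poly F}, (size A <= M)%N -> l A = 0.
Hypothesis l_Xn : l 'X^M != 0.
Hypothesis g_sum0 : \sum_v g v = 0.

Lemma sum_below_level U :
  \sum_(n < b ^ M) g (l (U + index_poly n)) = g (l U) *+ (b ^ M).
Proof.
under eq_bigr do rewrite lD (l_small (size_index_poly (ltn_ord _))) addr0.
by rewrite sumr_const card_ord.
Qed.

(** The coefficient of x^M runs freely over F, so [l] takes every value equally often and the
    mean-zero [g] cancels. *)
Lemma sum_above_level M' U : (M < M')%N ->
  \sum_(n < b ^ M') g (l (U + index_poly n)) = 0.
Proof.
elim: M' U => // M' IH U; rewrite ltnS leq_eqVlt => /orP[/eqP <-|MM'].
  rewrite (sum_index_polyS (fun A => g (l (U + A)))) exchange_big big1 //= => n _.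
  under eq_bigr do rewrite addrCA lD lZ.
  rewrite -[RHS]g_sum0 [RHS](reindex (fun c => c * l 'X^M + l (U + index_poly n))) //.
  exists (fun v => (v - l (U + index_poly n)) / l 'X^M) => c _.
    by rewrite addrK mulfK.
  by rewrite divfK // subrK.
rewrite (sum_index_polyS (fun A => g (l (U + A)))) big1 //= => c _.
by under eq_bigr do rewrite addrA; exact: IH.
Qed.

End Level.

Section SparseSum.
Variable M : nat -> nat.
Hypothesis M_gap : forall t, (M t + 3 <= M t.+1)%N.

Definition sparse_num (t : nat) : nat := \sum_(i < t) b ^ M i.

(** The gap 3 gives b^3 >= 4b, which carries the induction. The factor 2b later keeps the
    contribution of lower levels within half of the main term. *)
Lemma sparse_num_bound t : (2 * b * sparse_num t <= b ^ M t)%N.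
Proof.
elim: t => [|t IH]; first by rewrite /sparse_num big_ord0 muln0.
rewrite /sparse_num big_ord_recr -/(sparse_num t) /=.
have : (b ^ 3 * b ^ M t <= b ^ M t.+1)%N by rewrite -expnD leq_exp2l // addnC.
move: IH; move: (sparse_num t) (b ^ M t)%N (b ^ M t.+1)%N => N x z.
have : (2 * 2 * b <= b ^ 3)%N by rewrite !expnS expn0 muln1 !mulnA leq_mul // leq_mul.
move: (b ^ 3)%N b_gt0 => w; move: #|F| => c c0 cw IH wz.
have : (2 * 2 * c * x <= w * x)%N by rewrite leq_mul2r cw orbT.
have : (x <= c * x)%N by rewrite leq_pmull.
move: IH wz; rewrite -!mulnA mulnDr; move: (c * x)%N (c * N)%N (w * x)%N => u v k; lia.
Qed.

Lemma sparse_num_lt t : (sparse_num t < b ^ M t)%N.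
Proof.
have := sparse_num_bound t; have : (0 < b ^ M t)%N by rewrite expn_gt0 b_gt0.
move: (sparse_num t) (b ^ M t)%N => N x; nia.
Qed.

Lemma M_homo i j : (i < j)%N -> (M i < M j)%N.
Proof.
apply: (homo_ltn (r := fun x y => (x < y)%N)) => [x y z|k]; first exact: ltn_trans.
by have := M_gap k; lia.
Qed.

Lemma sum_sparseS (V : nmodType) (H : {poly F} -> V) t :
  \sum_(n < sparse_num t.+1) H (index_poly n) =
  \sum_(n < b ^ M t) H (index_poly n) +
  \sum_(n < sparse_num t) H ('X^(M t) * index_poly 1 + index_poly n).
Proof.
rewrite /sparse_num big_ord_recr /= addnC big_split_ord; congr (_ + _).
apply: eq_bigr => n _; rewrite /= -index_poly_block ?mul1n //.
exact: leq_trans (ltn_ord n) (ltnW (sparse_num_lt t)).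
Qed.

(* Blocks longer than b^(M t) contribute nothing, and on the block of length
   b^(M t) the form l is constant. *)
Lemma sum_sparse_level t T : (t < T)%N -> exists W : {poly F},
  forall (V : nmodType) (l : {poly F} -> F) (g : F -> V),
  (forall A B : {poly F}, l (A + B) = l A + l B) ->
  (forall a (A : {poly F}), l (a *: A) = a * l A) ->
  (forall A : {poly F}, (size A <= M t)%N -> l A = 0) -> l 'X^(M t) != 0 ->
  \sum_v g v = 0 ->
  exists h : nat -> F, \sum_(n < sparse_num T) g (l (index_poly n)) =
    g (l W) *+ (b ^ M t) + \sum_(n < sparse_num t) g (h n).
Proof.
move=> tT.
(* Generalised by a shift [U], which collects the leading terms of the blocks already passed. [W] is
   found before [l] and [g], so that a test function may be chosen depending on [l W]. *)
suff : exists W : {poly F}, forall U (V : nmodType) (l : {poly F} -> F) (g : F -> V),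
  (forall A B : {poly F}, l (A + B) = l A + l B) ->
  (forall a (A : {poly F}), l (a *: A) = a * l A) ->
  (forall A : {poly F}, (size A <= M t)%N -> l A = 0) -> l 'X^(M t) != 0 ->
  \sum_v g v = 0 ->
  exists h : nat -> F, \sum_(n < sparse_num T) g (l (U + index_poly n)) =
    g (l (U + W)) *+ (b ^ M t) + \sum_(n < sparse_num t) g (h n).
  move=> [W hW]; exists W => V l g lD lZ ls lX g0.
  have [h] := hW 0 V l g lD lZ ls lX g0; rewrite add0r => hE; exists h; rewrite -hE.
  by apply: eq_bigr => n _; rewrite add0r.
elim: T tT => // T IH; rewrite ltnS leq_eqVlt => /orP[/eqP <-|tT].
  exists 0 => U V l g lD lZ ls lX g0.
  exists (fun n => l (U + ('X^(M t) * index_poly 1 + index_poly n))).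
  rewrite (sum_sparseS (fun A => g (l (U + A)))).
  by rewrite (sum_below_level _ lD ls) addr0.
have [W hW] := IH tT; exists ('X^(M T) * index_poly 1 + W) => U V l g lD lZ ls lX g0.
have [h] := hW (U + 'X^(M T) * index_poly 1) V l g lD lZ ls lX g0.
rewrite -!addrA => hE; exists h; rewrite -hE.
rewrite (sum_sparseS (fun A => g (l (U + A)))) (sum_above_level lD lZ lX g0) ?M_homo //.
by rewrite add0r; apply: eq_bigr => n _; rewrite addrA.
Qed.

End SparseSum.
End IndexPoly.

Section CoordNum.
Variables (F : finFieldType) (phi : 'I_#|F| -> F) (phiV : F -> 'I_#|F|).
Hypothesis phiK : cancel phi phiV.
Hypothesis phiVK : cancel phiV phi.
Hypothesis phi0 : forall a : 'I_#|F|, val a = 0%N -> phi a = 0.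
Variables (p : {poly F}) (y : nat -> nat -> {poly F}).
Hypothesis p_nonconst : (1 <= deg p)%N.
Hypothesis y_indep : forall j, (1 <= j)%N -> lin_indep_mod p (y j).
Local Notation b := #|F|.

Definition coord_digit (A : {poly F}) (j : nat) : nat := phiV (row_form p y j A).

Lemma coord_digit_lt A j : (1 <= j)%N -> (coord_digit A j < b)%N.
Proof. by move=> _; exact: ltn_ord. Qed.

Definition coord_num (m : nat) (A : {poly F}) : nat :=
  digits_num b (coord_digit A) m.

Lemma coord_num_lt m A : (coord_num m A < b ^ m)%N.
Proof. exact: digits_num_lt (coord_digit_lt A) m. Qed.

Lemma phi_coord_num m A j : (1 <= j <= m)%N ->
  phi (digit F (coord_num m A) (m - j)) = row_form p y j A.
Proof.
move=> jm; rewrite -[RHS]phiVK; congr phi; apply: val_inj => /=.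
exact: digits_num_digit (coord_digit_lt A) m j jm.
Qed.

Lemma coord_num_eq_dvdp m A B : (deg p %| m)%N ->
  coord_num m A = coord_num m B -> p ^+ (m %/ deg p) %| A - B.
Proof.
move=> em e; apply: (row_form_dvdp p_nonconst y_indep) => j; rewrite divnK // => jm.
rewrite row_formD // -scaleN1r row_formZ // mulN1r.
by rewrite -!(@phi_coord_num m) // e subrr.
Qed.

(** By the divisibility, a nonzero difference of the two index polynomials would have degree at
    least m, yet both have degree below m. *)
Lemma coord_num_inj m n n' : (deg p %| m)%N -> (n < b ^ m)%N -> (n' < b ^ m)%N ->
  coord_num m (index_poly phi n) = coord_num m (index_poly phi n') -> n = n'.
Proof.
move=> em nm nm' /(coord_num_eq_dvdp em) dv; apply: (index_poly_inj phiK phi0).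
apply/eqP; rewrite -subr_eq0; apply: contraLR dv => h.
apply/negP => /(dvdp_leq h); rewrite (size_exp_deg p_nonconst) divnK // leqNgt ltnS.
by rewrite (leq_trans (size_polyD _ _)) // geq_max size_polyN !(size_index_poly phi0).
Qed.

Lemma output_digitE n j :
  output_digit phi (niederreiter_matrix p y) n j = row_form p y j (index_poly phi n).
Proof.
rewrite /index_poly poly_def row_form_sum //; apply: eq_bigr => r _.
by rewrite row_formZ // niederreiter_matrixE.
Qed.

End CoordNum.

Lemma prod_coprime_dvdp (F : fieldType) (I : eqType) (r : seq I) (q : I -> {poly F}) A :
  uniq r -> (forall i j, i != j -> coprimep (q i) (q j)) ->
  (forall i, q i %| A) -> \prod_(i <- r) q i %| A.
Proof.
move=> + cop dv; elim: r => [|i r IH] /=; first by rewrite big_nil dvd1p.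
move=> /andP[ir ur]; rewrite big_cons Gauss_dvdp ?dv ?IH //.
elim: r ir {IH ur} => [|j r IH]; first by rewrite big_nil coprimep1.
by rewrite inE negb_or big_cons coprimepMr => /andP[ij /IH ->]; rewrite cop.
Qed.

(** * Equidistribution by the Chinese remainder theorem *)

Section Equidistribution.
Variables (F : finFieldType) (phi : 'I_#|F| -> F) (phiV : F -> 'I_#|F|).
Hypothesis phiK : cancel phi phiV.
Hypothesis phiVK : cancel phiV phi.
Hypothesis phi0 : forall a : 'I_#|F|, val a = 0%N -> phi a = 0.
Variables (s : nat) (p : 'I_s -> {poly F}) (y : 'I_s -> nat -> nat -> {poly F}).
Hypothesis p_nonconst : forall i, (1 <= deg (p i))%N.
Hypothesis p_coprime : forall i i', i != i' -> coprimep (p i) (p i').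
Hypothesis y_indep : forall i j, (1 <= j)%N -> lin_indep_mod (p i) (y i j).
Hypothesis p_coprimeX : forall i, coprimep 'X (p i).
Variable m : nat.
Hypothesis deg_dvd : forall i, (deg (p i) %| m)%N.
Local Notation b := #|F|.

Definition box_index (A : {poly F}) : {ffun 'I_s -> 'I_(b ^ m)} :=
  [ffun i => Ordinal (coord_num_lt phiV (p i) (y i) m A)].

(** Both sides have b^(sm) elements, so injectivity suffices. If k and k' agree, the difference [D]
    of their index polynomials is divisible by the pairwise coprime p_i^(m/e_i), whose product has
    degree sm, while a nonzero [D] has degree below sm. *)
Lemma box_index_bij U M :
  bijective (fun k : 'I_(b ^ (s * m)) => box_index (U + 'X^M * index_poly phi k)).
Proof.
apply: inj_card_bij; last by rewrite card_ffun !card_ord -expnM mulnC.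
move=> k k' /ffunP e; apply: val_inj; apply: (index_poly_inj phiK phi0).
apply/eqP; rewrite -subr_eq0; set D := _ - _.
have dv i : p i ^+ (m %/ deg (p i)) %| D.
  have := e i; rewrite !ffunE => /(congr1 val) /=.
  move/(coord_num_eq_dvdp phiVK (p_nonconst i) (@y_indep i) (deg_dvd i)).
  rewrite opprD addrACA subrr add0r -mulrBr Gauss_dvdpr //.
  by rewrite coprimep_expl // coprimep_expr // coprimep_sym.
have dvP : \prod_i p i ^+ (m %/ deg (p i)) %| D.
  apply: prod_coprime_dvdp => //; first exact: index_enum_uniq.
  by move=> i j ij; rewrite coprimep_expl // coprimep_expr // p_coprime.
apply: contraLR dvP => D0; apply/negP => /(dvdp_leq D0).
rewrite size_prod => [|i _]; last by rewrite expf_neq0 // nonconst_neq0.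
under eq_bigr do rewrite size_exp_deg // divnK // -addn1.
rewrite big_split /= !sum_nat_const card_ord muln1 subSn ?leq_addl // addnK leqNgt ltnS.
by rewrite (leq_trans (size_polyD _ _)) // geq_max size_polyN !(size_index_poly phi0) ?ltn_ord.
Qed.

Lemma sum_box_index (V : nmodType) (g : {ffun 'I_s -> 'I_(b ^ m)} -> V) U M :
  \sum_(k < b ^ (s * m)) g (box_index (U + 'X^M * index_poly phi k)) = \sum_T g T.
Proof. by rewrite [RHS](reindex _ (onW_bij _ (box_index_bij U M))). Qed.

End Equidistribution.

(** * Level values along an initial segment of the integers *)

Section LevelCount.
Variables (F : finFieldType) (phi : 'I_#|F| -> F) (phiV : F -> 'I_#|F|).
Hypothesis phiK : cancel phi phiV.
Hypothesis phiVK : cancel phiV phi.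
Variables (r : nat) (kappa : nat -> F).
Local Notation b := #|F|.

Let b_gt0 : (0 < b)%N := card_field_gt0 F.

Let br_gt0 : (0 < b ^ r)%N.
Proof. by rewrite expn_gt0 b_gt0. Qed.

(* The value of a form of level m - r at a point whose first m digits in base b
   are those of the integer x; kappa collects the terms of lower level. *)
Definition level_value (x : nat) : F := phi (digit F x r) + kappa (x %/ b ^ r.+1).

Lemma level_value_block (z : nat) (c : 'I_b) (u : 'I_(b ^ r)) :
  level_value (z * (b * b ^ r) + (c * b ^ r + u)) = phi c + kappa z.
Proof.
have lt : (c * b ^ r + u < b * b ^ r)%N.
  by rewrite (leq_trans _ (_ : c.+1 * b ^ r <= _)%N) ?leq_mul // mulSnr ltn_add2l.
rewrite /level_value; congr (phi _ + kappa _); last first.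
  by rewrite expnS divnMDl ?muln_gt0 ?b_gt0 // divn_small ?addn0.
apply: val_inj => /=; rewrite mulnA divnMDl // divnMDl //.
by rewrite (divn_small (ltn_ord u)) addn0 modnMDl modn_small.
Qed.

(** On a block of b^(r+1) consecutive integers the higher digits are fixed, while digit r takes each
    value b^r times. *)
Lemma sum_level_value (V : nmodType) (H : nat -> F -> V) c :
  (forall z, \sum_v H z v = 0) ->
  \sum_(x < c * b ^ r.+1) H (x %/ b ^ r.+1)%N (level_value x) = 0.
Proof.
move=> H0; rewrite (sum_mul_blocks c _ (fun x => H (x %/ b ^ r.+1)%N (level_value x))).
rewrite big1 // => z _; rewrite expnS.
rewrite (sum_mul_blocks b _ (fun x => H ((z * (b * b ^ r) + x) %/ (b * b ^ r))%N
                                       (level_value (z * (b * b ^ r) + x)))).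
transitivity (\sum_(v < b) H z (phi v + kappa z) *+ (b ^ r)).
  apply: eq_bigr => v _; rewrite -[in RHS](card_ord (b ^ r)) -sumr_const.
  apply: eq_bigr => u _; rewrite level_value_block divnMDl ?muln_gt0 ?b_gt0 //.
  rewrite divn_small ?addn0 //.
  by rewrite (leq_trans _ (_ : v.+1 * b ^ r <= _)%N) ?leq_mul // mulSnr ltn_add2l.
rewrite sumrMnl; suff -> : \sum_(v < b) H z (phi v + kappa z) = 0 by rewrite mul0rn.
rewrite -[RHS](H0 z) [RHS](reindex (fun v : 'I_b => phi v + kappa z)) //.
exists (fun v => phiV (v - kappa z)) => v _; first by rewrite addrK phiK.
by rewrite phiVK subrK.
Qed.

Lemma sum_eq_divn (n B c : nat) : (0 < B)%N ->
  (\sum_(x < n) (x %/ B == c) = minn (n - c * B) B)%N.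
Proof.
move=> B0; elim: n => [|n IH]; first by rewrite big_ord0 sub0n min0n.
rewrite big_ord_recr /= IH.
have -> : ((n %/ B)%N == c) = ((c * B <= n) && (n < c * B + B))%N.
  by rewrite eqn_leq -ltnS ltn_divLR // mulSnr andbC leq_divRL.
by move: (c * B)%N => cB; case: leqP; case: ltnP => /=; lia.
Qed.

Definition diff_test {R : pzRingType} (a1 a2 v : F) : R := (v == a1)%:R - (v == a2)%:R.

Lemma sum_diff_test (R : pzRingType) a1 a2 : \sum_v diff_test a1 a2 v = 0 :> R.
Proof.
have one a : \sum_v (v == a)%:R = 1 :> R.
  by rewrite (bigD1 a) //= eqxx big1 ?addr0 // => v /negbTE ->.
by rewrite sumrB !one subrr.
Qed.

(** Complete blocks cancel. In the last, incomplete block the points of level value a share one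
    digit r, so they form an interval of length b^r, cut off at G. *)
Lemma sum_diff_test_level (R : pzRingType) G a1 a2 :
  let c a := (G %% b ^ r.+1 - phiV (a - kappa (G %/ b ^ r.+1)%N)%R * b ^ r)%N in
  \sum_(x < G) diff_test a1 a2 (level_value x) =
  (minn (c a1) (b ^ r))%:R - (minn (c a2) (b ^ r))%:R :> R.
Proof.
move=> c; rewrite -(big_mkord xpredT (fun x => diff_test a1 a2 (level_value x))).
rewrite {1}(divn_eq G (b ^ r.+1)) big_mkord big_split_ord /=.
rewrite (@sum_level_value _ (fun _ => diff_test a1 a2)) ?add0r; last first.
  by move=> _; exact: sum_diff_test.
rewrite sumrB.
suff one a : \sum_(x < G %% b ^ r.+1)
    (level_value (G %/ b ^ r.+1 * b ^ r.+1 + x) == a)%:R = (minn (c a) (b ^ r))%:R :> R.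
  by rewrite !one.
rewrite -sum_eq_divn // natr_sum; apply: eq_bigr => x _; congr (_%:R).
have xlt : (x < b ^ r.+1)%N.
  by rewrite (leq_trans (ltn_ord x)) // ltnW // ltn_pmod // expn_gt0 b_gt0.
have xr : (x %/ b ^ r < b)%N by rewrite ltn_divLR // -expnS.
have := level_value_block (G %/ b ^ r.+1) (Ordinal xr) (Ordinal (ltn_pmod x br_gt0)).
rewrite /= -divn_eq -expnS => ->.
by rewrite eq_sym -subr_eq -(inj_eq (can_inj phiVK)) phiK eq_sym.
Qed.

End LevelCount.

(** * Boxes with finite expansions *)

Section BadicSum.
Variables (R : realType) (b : nat) (d : nat -> nat).
Hypothesis b_gt1 : (1 < b)%N.

Let b_neq0 : b%:R != 0 :> R.
Proof. by rewrite pnatr_eq0; case: b b_gt1. Qed.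

Lemma digits_numE m :
  \sum_(1 <= j < m.+1) ((d j)%:R / b%:R ^+ j) = (digits_num b d m)%:R / b%:R ^+ m :> R.
Proof.
elim: m => [|m IH]; first by rewrite big_geq // mul0r.
rewrite big_nat_recr //= IH natrD natrM exprS invfM; field.
by rewrite expf_neq0.
Qed.

Hypothesis d_lt : forall j, (1 <= j)%N -> (d j < b)%N.

(** The tail after m places lies between 0 and 1 in units of b^-m. It equals 1 when all later digits
    are b - 1, so the upper bound is not strict. *)
Lemma badic_sum_bounds m :
  (digits_num b d m)%:R <= b%:R ^+ m * badic_sum R b d <= (digits_num b d m)%:R + 1.
Proof.
have bX n : 0 < b%:R ^+ n :> R by rewrite exprn_gt0 // ltr0n; case: b b_gt1.
rewrite /badic_sum; under eq_fun do rewrite digits_numE.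
set S := fun n => _.
have bnd n : (m <= n)%N -> (digits_num b d m)%:R / b%:R ^+ m <= S n <=
    ((digits_num b d m)%:R + 1) / b%:R ^+ m.
  move=> mn; rewrite natr1 /S.
  have [lo hi] : (digits_num b d m * b ^ n <= digits_num b d n * b ^ m /\
                  digits_num b d n * b ^ m <= (digits_num b d m).+1 * b ^ n)%N.
    have := digits_num_div d_lt (leq_subr m n); rewrite subKn // => <-.
    have -> : (b ^ n = b ^ (n - m) * b ^ m)%N by rewrite -expnD subnK.
    rewrite !mulnA !leq_pmul2r ?expn_gt0 ?(ltnW b_gt1) // leq_trunc_div.
    by split=> //; rewrite ltnW // ltn_ceil // expn_gt0 (ltnW b_gt1).
  apply/andP; split.
    by rewrite ler_pdivrMr // mulrAC ler_pdivlMr // -!natrX -!natrM ler_nat.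
  by rewrite ler_pdivrMr // mulrAC ler_pdivlMr // -!natrX -!natrM ler_nat.
have ndS : nondecreasing_seq S.
  apply/nondecreasing_seqP => n; rewrite /S -!digits_numE [leRHS]big_nat_recr //= lerDl.
  by rewrite divr_ge0 // exprn_ge0.
have cS : cvgn S.
  apply: nondecreasing_is_cvgn => //; exists (((digits_num b d m)%:R + 1) / b%:R ^+ m).
  move=> _ [n _ <-]; apply: le_trans (ndS n (maxn n m) (leq_maxl _ _)) _.
  by have /andP[] := bnd (maxn n m) (leq_maxr _ _).
apply/andP; split.
  rewrite mulrC -ler_pdivrMr //; apply: limr_ge => //.
  by apply: filterS (nbhs_infty_ge m) => n /bnd /andP[].
rewrite mulrC -ler_pdivlMr //; apply: limr_le => //.
by apply: filterS (nbhs_infty_ge m) => n /bnd /andP[].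
Qed.

End BadicSum.

Section BoolProducts.
Variables (R : realType).

Lemma prod_nat_forall (I : finType) (P : pred I) :
  \prod_i (P i)%:R = [forall i, P i]%:R :> R.
Proof.
case: (boolP [forall i, P i]) => [/forallP h|].
  by rewrite big1 // => i _; rewrite h.
by rewrite negb_forall => /existsP[i /negbTE Pi]; rewrite (bigD1 i) //= Pi mul0r.
Qed.

(** The conjunctions can differ only when some index satisfies [E], and then the right side is at
    least 1. *)
Lemma dist_forall_le (I : finType) (P Q E : pred I) :
  (forall i, ~~ E i -> P i = Q i) ->
  `|[forall i, P i]%:R - [forall i, Q i]%:R| <= \sum_i (E i)%:R :> R.
Proof.
move=> h; case: (boolP [exists i, E i]) => [/existsP[i Ei]|].
  apply: (@le_trans _ _ 1).
    by case: [forall i, P i]; case: [forall i, Q i];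
      rewrite ?subrr ?subr0 ?sub0r ?normrN ?normr1 ?normr0.
  by rewrite (bigD1 i) //= Ei lerDl sumr_ge0.
rewrite negb_exists => /forallP nE; have -> : [forall i, P i] = [forall i, Q i].
  by apply: eq_forallb => i; rewrite h.
by rewrite subrr normr0 sumr_ge0.
Qed.

Lemma sum_ffun_forall (I : finType) (X : finType) (P : I -> pred X) :
  \sum_(T : {ffun I -> X}) [forall i, P i (T i)]%:R =
  \prod_i (\sum_x (P i x)%:R) :> R.
Proof.
by rewrite bigA_distr_bigA; apply: eq_bigr => T _; rewrite prod_nat_forall.
Qed.

Lemma sum_mul_ltn (n G : nat) (h : nat -> R) : (G <= n)%N ->
  \sum_(x < n) (x < G)%N%:R * h x = \sum_(x < G) h x.
Proof.
move=> Gn; rewrite (big_ord_widen _ h Gn) [RHS]big_mkcond /=.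
by apply: eq_bigr => x _; case: ltnP; rewrite ?mul1r ?mul0r.
Qed.

Lemma sum_ltn (n G : nat) : (G <= n)%N -> \sum_(x < n) (x < G)%N%:R = G%:R :> R.
Proof.
move=> Gn; under eq_bigr do rewrite -[_%:R]mulr1.
by rewrite (sum_mul_ltn (fun=> 1)) // sumr_const card_ord.
Qed.

Lemma sum_eq_inj_le1 (N : nat) (f : nat -> nat) v :
  (forall n n', (n < N)%N -> (n' < N)%N -> f n = f n' -> n = n') ->
  \sum_(n < N) (f n == v)%:R <= 1 :> R.
Proof.
move=> finj; rewrite -natr_sum -big_mkcond /= sum1_card (ler_nat _ _ 1).
apply/card_le1_eqP => n n' /eqP fn /eqP fn'; apply: val_inj; apply: finj; rewrite ?ltn_ord //.
exact: etrans (esym fn).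
Qed.

End BoolProducts.

(** With m divisible by all deg p_i, the first m digits of each coordinate amount to a residue class
    modulo a power of p_i; [L] lets m be as large as desired. *)
Lemma common_multiple (s : nat) (e : 'I_s -> nat) (L : nat) :
  (forall i, (0 < e i)%N) -> exists2 m, (L <= m)%N & forall i, (e i %| m)%N.
Proof.
move=> e0; exists (L * \prod_i e i)%N; last first.
  by move=> i; rewrite (bigD1 i) //= mulnCA dvdn_mulr.
by rewrite leq_pmulr // prodn_gt0.
Qed.

Section NiederreiterBox.
Variables (R : realType) (F : finFieldType).
Variables (phi : 'I_#|F| -> F) (phiV : F -> 'I_#|F|).
Hypothesis phiK : cancel phi phiV.
Hypothesis phiVK : cancel phiV phi.
Hypothesis phi0 : forall a : 'I_#|F|, val a = 0%N -> phi a = 0.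
Variables (s : nat) (p : 'I_s -> {poly F}) (y : 'I_s -> nat -> nat -> {poly F}).
Hypothesis p_nonconst : forall i, (1 <= deg (p i))%N.
Hypothesis p_coprime : forall i i', i != i' -> coprimep (p i) (p i').
Hypothesis y_indep : forall i j, (1 <= j)%N -> lin_indep_mod (p i) (y i j).
Hypothesis p_coprimeX : forall i, coprimep 'X (p i).
Variable gamma : 'I_s -> R.
Hypothesis gamma01 : forall i, 0 < gamma i < 1.
Local Notation b := #|F|.
Local Notation x_ := (niederreiter_sequence R phi phiV p y).
Local Notation num i m n := (coord_num phiV (p i) (y i) m (index_poly phi n)).

Let b_gt1 : (1 < b)%N := card_field_gt1 F.

Let bX_gt0 m : 0 < b%:R ^+ m :> R.
Proof. by rewrite exprn_gt0 // ltr0n ltnW. Qed.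

Lemma niederreiter_coord_bounds i m n :
  (num i m n)%:R <= b%:R ^+ m * tnth (x_ n) i <= (num i m n)%:R + 1.
Proof.
rewrite tnth_mktuple /digital_coord.
under eq_fun do rewrite output_digitE //.
by apply: (badic_sum_bounds R b_gt1 _ m) => j _; exact: ltn_ord.
Qed.

(** Coordinates of the sequence are nonnegative, so this is membership in the box. *)
Definition in_box (n : nat) : bool := [forall i, tnth (x_ n) i < gamma i].

Lemma indic_box n : \1_(box gamma) (x_ n) = (in_box n)%:R :> R.
Proof.
rewrite indicE; congr ((nat_of_bool _)%:R); apply/idP/forallP => [|h].
  by rewrite inE => h i; have /andP[] := h i.
rewrite inE => i /=; rewrite h andbT.
by have /andP[+ _] := niederreiter_coord_bounds i 0 n; rewrite expr0 mul1r.
Qed.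

Lemma discrepancy_box N : discrepancy x_ (box gamma) N =
  \sum_(n < N) ((in_box n)%:R - \prod_i gamma i).
Proof.
rewrite /discrepancy; have g0 i : 0 <= gamma i by have /andP[/ltW] := gamma01 i.
by rewrite (lebesgue_tuple_box g0).2 /=; under eq_bigr do rewrite indic_box.
Qed.

Lemma finite_expansion_bounded :
  (forall i, has_finite_badic_expansion b (gamma i)) ->
  bounded_remainder_set x_ (box gamma).
Proof.
(* A common denominator b^m for all gamma_i, with m also divisible by every deg p_i. *)
move=> fin; have [m [G [em GE]]] : exists m, exists G : 'I_s -> nat,
    (forall i, (deg (p i) %| m)%N) /\ forall i, b%:R ^+ m * gamma i = (G i)%:R.
  have /choice[m0 hm0] (i : 'I_s) : exists mi, exists Gi : nat, b%:R ^+ mi * gamma i = Gi%:R.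
    have [mi [di [_ ->]]] := fin i; exists mi, (digits_num b di mi).
    by rewrite digits_numE // mulrC divfK // gt_eqF.
  have /choice[G0 hG0] := hm0.
  have [m mge em] := common_multiple (\sum_i m0 i) p_nonconst.
  exists m, (fun i => b ^ (m - m0 i) * G0 i)%N; split=> // i.
  have mi : (m0 i <= m)%N by rewrite (leq_trans _ mge) // (bigD1 i) //= leq_addr.
  by rewrite natrM natrX -hG0 mulrA -exprD subnK.
have Gb i : (G i <= b ^ m)%N.
  rewrite -(ler_nat R) -GE natrX ler_piMr ?(ltW (bX_gt0 m)) //.
  by have /andP[_ /ltW] := gamma01 i.
(* Membership as decided by the first m digits; it differs from [in_box] only at points with some
   coordinate equal to gamma_i. *)
pose f0 n : bool := [forall i, (num i m n < G i)%N].
pose lam := \prod_i gamma i.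
have lamE : b%:R ^+ (s * m) * lam = \prod_i (G i)%:R.
  under [RHS]eq_bigr do rewrite -GE.
  by rewrite big_split /= prodr_const card_ord -exprM mulnC.
have lam01 : 0 <= lam <= 1.
  apply/andP; split; first by apply: prodr_ge0 => i _; have /andP[/ltW] := gamma01 i.
  by apply: prodr_ile1 => i _; have /andP[/ltW -> /ltW ->] := gamma01 i.
pose D := (b ^ (s * m))%N.
have D0 : (0 < D)%N by rewrite expn_gt0 ltnW.
(* A block of b^(sm) indices meets every digit pattern once, and the product of the G_i, which is
   b^(sm) [lam], counts the accepted patterns. *)
have block a : \sum_(n < D) ((f0 (a * D + n)%N)%:R - lam) = 0.
  rewrite sumrB sumr_const card_ord -mulr_natl natrX lamE; apply/eqP; rewrite subr_eq0; apply/eqP.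
  pose f T : R := [forall i, ((T : {ffun 'I_s -> 'I_(b ^ m)}) i < G i)%N]%:R.
  transitivity (\sum_T f T); last first.
    rewrite (sum_ffun_forall R (fun i (x : 'I_(b ^ m)) => (x < G i)%N)); apply: eq_bigr => i _.
    exact: sum_ltn.
  rewrite -(sum_box_index phiK phiVK phi0 p_nonconst p_coprime y_indep p_coprimeX em
              f ('X^(s * m) * index_poly phi a) 0).
  apply: eq_bigr => n _; rewrite /f /f0 expr0 mul1r index_poly_block //.
  by congr (nat_of_bool _)%:R; apply: eq_forallb => i; rewrite ffunE.
have bnd0 N : `|\sum_(n < N) ((f0 n)%:R - lam)| <= D%:R.
  rewrite (divn_eq N D) big_split_ord /= (sum_mul_blocks _ _ (fun n => (f0 n)%:R - lam)).
  rewrite big1 ?add0r //.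
  apply: le_trans (ler_norm_sum _ _ _) _.
  apply: (@le_trans _ _ (\sum_(n < N %% D) 1)).
    apply: ler_sum => n _; rewrite ler_norml; case/andP: lam01 => l0 l1.
    case: (f0 _); rewrite /= ?mulr1n ?mulr0n; apply/andP; split; lra.
  by rewrite sumr_const card_ord ler_nat ltnW // ltn_pmod.
(* Take m' with N <= b^m'. If coordinate i equals gamma_i, the integer of its first m' digits is G'
   or G' - 1, and by injectivity each of these occurs for at most one n < N. *)
have exc N i : \sum_(n < N) (tnth (x_ n) i == gamma i)%:R <= 2 :> R.
  have [m' mN e'] := common_multiple (m + N) p_nonconst.
  have mm' : (m <= m')%N by rewrite (leq_trans (leq_addr _ _) mN).
  have Nb : (N <= b ^ m')%N.
    by rewrite (leq_trans (leq_addl m N)) // (leq_trans mN) // ltnW // ltn_expl.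
  pose G' := (b ^ (m' - m) * G i)%N.
  have G'E : b%:R ^+ m' * gamma i = G'%:R by rewrite natrM natrX -GE mulrA -exprD subnK.
  have inj v : \sum_(n < N) (num i m' n == v)%:R <= 1 :> R.
    apply: (sum_eq_inj_le1 R (f := fun n => num i m' n)) => n n' nN nN'.
    apply: coord_num_inj => //; first exact: (y_indep (i := i)).
      exact: leq_trans Nb.
    exact: leq_trans Nb.
  apply: (@le_trans _ _ (\sum_(n < N) ((num i m' n == G')%:R + (num i m' n == G'.-1)%:R))).
    apply: ler_sum => n _; case: eqP => [e|_]; last by rewrite addr_ge0.
    have := niederreiter_coord_bounds i m' n; rewrite e G'E natr1 !ler_nat.
    move=> /andP[h1 h2]; rewrite -natrD (ler_nat _ 1).
    by case: eqP => //; case: eqP => //; lia.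
  by rewrite big_split /=; have := inj G'; have := inj G'.-1; lra.
exists (D%:R + (\sum_(i < s) 2)) => _ [N _ <-]; rewrite discrepancy_box.
have -> : \sum_(n < N) ((in_box n)%:R - \prod_i gamma i) =
    \sum_(n < N) ((f0 n)%:R - lam) + \sum_(n < N) ((in_box n)%:R - (f0 n)%:R).
  by rewrite -big_split; apply: eq_bigr => n _ /=; rewrite addrC subrKA.
apply: le_trans (ler_normD _ _) _; apply: lerD => //.
apply: le_trans (ler_norm_sum _ _ _) _.
apply: (@le_trans _ _ (\sum_(n < N) \sum_i (tnth (x_ n) i == gamma i)%:R)).
  apply: ler_sum => n _; apply: dist_forall_le => i ne.
  have /andP[h1 h2] := niederreiter_coord_bounds i m n.
  have [lt|ge] := ltnP (num i m n) (G i).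
    rewrite lt_neqAle ne /= -(ler_pM2l (bX_gt0 m)) GE (le_trans h2) //.
    by rewrite natr1 ler_nat.
  apply/negbTE; rewrite -leNgt -(ler_pM2l (bX_gt0 m)) GE (le_trans _ h1) //.
  by rewrite ler_nat.
by rewrite exchange_big /=; apply: ler_sum => i _; exact: exc.
Qed.

End NiederreiterBox.

(** * Infinite expansions *)

Section ActiveDigits.
Local Open Scope nat_scope.
Variables (b : nat) (d : nat -> nat).
Hypothesis b_gt1 : 1 < b.
Hypothesis d_lt : forall j, 1 <= j -> d j < b.

(* Digits J and J+1 are neither both 0 nor both b-1. *)
Definition active (J : nat) : bool :=
  (0 < d J * b + d J.+1) && ((d J * b + d J.+1).+1 < b * b).

(** An inactive J whose digit is 0 or b - 1 passes this digit on to J+1. Were all J from some place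
    on inactive, the digits would stay constantly 0 or constantly b - 1. *)
Lemma active_unbounded :
  (forall K, exists2 j, K <= j & d j <> 0) ->
  (forall K, exists2 j, K <= j & d j <> b.-1) ->
  forall K, exists2 J, K <= J & active J.
Proof.
move=> nz nb K; apply: contrapT => na.
have const c : (forall j, maxn K 1 <= j -> ~~ active j -> d j = c -> d j.+1 = c) ->
    d (maxn K 1) = c -> forall j, maxn K 1 <= j -> d j = c.
  move=> step d1; elim=> [|j IH]; first by rewrite leqn0 => /eqP k; lia.
  rewrite leq_eqVlt => /orP[/eqP <- //|jK]; apply: step => //; last exact: IH.
  by apply/negP => aj; apply: na; exists j => //; lia.
have step c : c = 0 \/ c = b.-1 -> forall j, maxn K 1 <= j -> ~~ active j -> d j = c -> d j.+1 = c.
  move=> c01 j j1; rewrite /active => + dj; rewrite dj => {dj}.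
  by have := @d_lt j.+1 isT; move: (d j.+1) => x; case: c01 => ->; nia.
have : ~~ active (maxn K 1).
  by apply/negP => aj; apply: na; exists (maxn K 1) => //; lia.
have l1 : 1 <= maxn K 1 by lia.
have [d0|d0] := eqVneq (d (maxn K 1)) 0.
  by have [j Kj] := nz (maxn K 1); rewrite (const 0) //; apply: step; left.
have [d1|d1] := eqVneq (d (maxn K 1)) b.-1.
  by have [j Kj] := nb (maxn K 1); rewrite (const b.-1) //; apply: step; right.
rewrite /active; have := d_lt l1; have := @d_lt (maxn K 1).+1 isT.
move: d0 d1; move: (d (maxn K 1)) (d (maxn K 1).+1) => x z x0 x1 zb xb; nia.
Qed.

(** Digits J and J+1 lead the remainder modulo b^(r+2) and form a number from 1 to b^2 - 2, so the
    remainder keeps a distance b^r from both ends of its range. *)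
Lemma active_mod J r : 1 <= J -> active J ->
  b ^ r <= digits_num b d (J + r.+1) %% b ^ r.+2 <= b * b ^ r.+1 - b ^ r.
Proof.
move=> J1 /andP[]; set w := d J * b + d J.+1 => w0 w1.
have br : 0 < b ^ r by rewrite expn_gt0 (ltnW b_gt1).
have := digits_num_div d_lt (leq_trans (leqnSn r) (leq_addl J r.+1)).
rewrite (_ : J + r.+1 - r = J.+1); last by lia.
have -> : digits_num b d J.+1 = digits_num b d J.-1 * (b * b) + w.
  by rewrite /w -[in LHS](prednK J1) /= prednK //; ring.
move: (digits_num b d (J + r.+1)) => G h.
rewrite (divn_eq G (b ^ r)) h mulnDl -addnA -mulnA -(mulnA b b) -!expnS modnMDl.
have u1 := ltn_pmod G br; move: (G %% b ^ r) u1 => u u1.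
have e : b * b ^ r.+1 = b * b * b ^ r by rewrite expnS mulnA.
have lt : w * b ^ r + u < b ^ r.+2 - b ^ r.
  rewrite ltn_subRL expnS e; apply: (@leq_trans (w.+2 * b ^ r)).
    by rewrite !mulSnr; lia.
  by rewrite leq_mul2r; apply/orP; right.
rewrite modn_small; last by rewrite (leq_trans lt) // leq_subr.
by rewrite (ltnW lt) (leq_trans _ (leq_addr _ _)) // leq_pmull.
Qed.

(** Compares the first and the last of b intervals of length B, cut off at G0. If the cut falls
    before the last one, that one is empty while the first has at least B' points; otherwise the
    first is full and the last misses at least B'. *)
Lemma minn_gap (B B' G0 : nat) : B = b * B' -> B' <= G0 <= b * B - B' ->
  minn (G0 - b.-1 * B) B + B' <= minn G0 B.
Proof.
move=> BE /andP[h1 h2].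
have e : b * B = b.-1 * B + B by rewrite -mulSnr prednK // ltnW.
have h3 : B <= b.-1 * B by rewrite leq_pmull // -subn1 subn_gt0.
have h4 : 2 * B' <= B by rewrite BE leq_mul2r b_gt1 orbT.
move: e h2 h3; move: (b * B) (b.-1 * B) => u v; lia.
Qed.

End ActiveDigits.

Section LevelValues.
Variables (F : finFieldType) (phi : 'I_#|F| -> F) (phiV : F -> 'I_#|F|).
Hypothesis phiK : cancel phi phiV.
Hypothesis phiVK : cancel phiV phi.
Local Notation b := #|F|.

Let b_gt0 : (0 < b)%N := card_field_gt0 F.
Let b_gt1 : (1 < b)%N := card_field_gt1 F.

Lemma digit_div (x r t : nat) : digit F (x %/ b ^ t) r = digit F x (t + r).
Proof. by apply: val_inj; rewrite /= -divnMA -expnD. Qed.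

Definition lower_part (w : nat -> F) (J z : nat) : F :=
  \sum_(j < J.-1) w j * phi (digit F z (J.-1 - j.+1)).

Lemma level_valueE (p : {poly F}) (y : nat -> nat -> {poly F})
    (w : nat -> F) (J m : nat) (A : {poly F}) :
  (1 <= J <= m)%N ->
  row_form p y J A + \sum_(j < J.-1) w j * row_form p y j.+1 A =
  level_value phi (m - J) (lower_part w J) (coord_num phiV p y m A).
Proof.
move=> /andP[J1 Jm]; rewrite /level_value phi_coord_num ?J1 //; congr (_ + _).
apply: eq_bigr => j _; congr (_ * _); have := ltn_ord j => jJ.
rewrite digit_div -(@phi_coord_num _ _ _ phiVK p y m) //; last by lia.
by congr (phi (digit F _ _)); lia.
Qed.

Lemma level_value_top r r' (kappa : nat -> F) x : (r' < r)%N ->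
  level_value phi r kappa x =
  level_value phi (r - r'.+1) kappa (x %/ b ^ r'.+1).
Proof.
move=> rr; rewrite /level_value digit_div subnKC // -divnMA -expnD.
by congr (_ + kappa (_ %/ b ^ _)%N); lia.
Qed.

Lemma sum_level_value0 (V : nmodType) r (kappa : nat -> F) m (h : F -> V) : (r < m)%N ->
  \sum_v h v = 0 -> \sum_(x < b ^ m) h (level_value phi r kappa x) = 0.
Proof.
move=> rm h0; rewrite -(subnK rm) expnD.
exact: (sum_level_value phiK phiVK _ _ (H := fun=> h)).
Qed.

(** Fixing all digits above place r' fixes the first factor, as r' < r, while the second still runs
    through all values equally often. *)
Lemma level_values_orthogonal (V : comPzRingType) r r' (kappa kappa' : nat -> F) m
    (h h' : F -> V) : (r' < r < m)%N -> \sum_v h' v = 0 ->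
  \sum_(x < b ^ m) h (level_value phi r kappa x) * h' (level_value phi r' kappa' x) = 0.
Proof.
move=> /andP[rr rm] h0; have r'm : (r'.+1 <= m)%N by lia.
rewrite -(subnK r'm) expnD; under eq_bigr do rewrite (level_value_top _ _ rr).
apply: (sum_level_value phiK phiVK _ _
  (H := fun z v => h (level_value phi (r - r'.+1) kappa z) * h' v)) => z.
by rewrite -mulr_sumr h0 mulr0.
Qed.

Lemma diff_test_shift (R : pzRingType) (a1 a2 v u : F) :
  diff_test a1 a2 (v - u) = diff_test (a1 + u) (a2 + u) v :> R.
Proof. by rewrite /diff_test !subr_eq. Qed.

Section Gap.
Variables (R : realType) (G r : nat) (kappa : nat -> F).
Hypothesis G_active : (b ^ r <= G %% b ^ r.+2 <= b * b ^ r.+1 - b ^ r)%N.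

Let z := kappa (G %/ b ^ r.+2)%N.
(** Up to the shift u, the two values tested are those taken on the first and the last of the b
    subintervals of the block of length b^(r+2) containing [G]. *)
Definition gap_test (u : F) : F -> R :=
  diff_test (phi (Ordinal b_gt0) + z - u)
            (phi (Ordinal (ltac:(by rewrite prednK) : (b.-1 < b)%N)) + z - u).

(** Each sum is a difference of two interval counts between 0 and b^(r+1); at the matching shift u
    it is the gap produced by the active digits. *)
Lemma gap_testP u :
  [/\ \sum_v gap_test u v = 0, forall v, `|gap_test u v| <= 1,
      forall u', `|\sum_(x < G) gap_test u (level_value phi r.+1 kappa x - u')| <=
         b%:R ^+ r.+1 &
      b%:R ^+ r <= \sum_(x < G) gap_test u (level_value phi r.+1 kappa x - u)].
Proof.
split.
- exact: sum_diff_test.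
- by move=> v; rewrite /gap_test /diff_test; case: eqP; case: eqP => _ _;
    rewrite ?subrr ?subr0 ?sub0r ?normrN ?normr1 ?normr0.
- move=> u'; under eq_bigr do rewrite /gap_test diff_test_shift.
  rewrite (sum_diff_test_level phiK phiVK) -natrX.
  set c1 := minn _ _; set c2 := minn _ _.
  have : (c1 <= b ^ r.+1)%N by exact: geq_minr.
  have : (c2 <= b ^ r.+1)%N by exact: geq_minr.
  rewrite -!(ler_nat R) ler_norml.
  have := ler0n R c1; have := ler0n R c2; lra.
- under eq_bigr do rewrite /gap_test diff_test_shift.
  rewrite (sum_diff_test_level phiK phiVK) -/z !subrK !addrK !phiK /= mul0n subn0.
  rewrite lerBrDr -natrX -natrD ler_nat addnC; apply: minn_gap => //.
  by rewrite expnS.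
Qed.

End Gap.
End LevelValues.

Section CoordinateSums.
Variables (R : comPzRingType) (I X : finType) (i0 : I).

Lemma sum_ffun_coord (h : X -> R) (g : I -> X -> R) :
  \sum_(T : {ffun I -> X}) h (T i0) * \prod_(i | i != i0) g i (T i) =
  (\sum_x h x) * \prod_(i | i != i0) \sum_x g i x.
Proof.
pose F i x := if i == i0 then h x else g i x.
transitivity (\prod_i \sum_x F i x).
  rewrite bigA_distr_bigA; apply: eq_bigr => T _; rewrite [RHS](bigD1 i0) //= /F eqxx.
  by congr (_ * _); apply: eq_bigr => i /negbTE ->.
rewrite [LHS](bigD1 i0) //= /F eqxx; congr (_ * _).
by apply: eq_bigr => i /negbTE ->.
Qed.

Lemma sum_ffun_eval (h : X -> R) :
  #|X|%:R * (\sum_(T : {ffun I -> X}) h (T i0)) = (\sum_x h x) * (#|X| ^ #|I|)%:R.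
Proof.
have -> : \sum_(T : {ffun I -> X}) h (T i0) =
    \sum_(T : {ffun I -> X}) h (T i0) * \prod_(i | i != i0) 1.
  by apply: eq_bigr => T _; rewrite big1 ?mulr1.
rewrite (sum_ffun_coord h (fun _ _ => 1)) mulrCA; congr (_ * _).
rewrite natrX -[in RHS](prodr_const I) [RHS](bigD1 i0) //=; congr (_ * _).
by apply: eq_bigr => i _; rewrite sumr_const.
Qed.

End CoordinateSums.

(** * Correlation of the box count with one level *)

Section Correlation.
Variables (R : realType) (F : finFieldType).
Variables (phi : 'I_#|F| -> F) (phiV : F -> 'I_#|F|).
Hypothesis phiK : cancel phi phiV.
Hypothesis phiVK : cancel phiV phi.
Hypothesis phi0 : forall a : 'I_#|F|, val a = 0%N -> phi a = 0.
Variables (s : nat) (p : 'I_s -> {poly F}) (y : 'I_s -> nat -> nat -> {poly F}).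
Hypothesis p_nonconst : forall i, (1 <= deg (p i))%N.
Hypothesis p_coprime : forall i i', i != i' -> coprimep (p i) (p i').
Hypothesis y_indep : forall i j, (1 <= j)%N -> lin_indep_mod (p i) (y i j).
Hypothesis p_coprimeX : forall i, coprimep 'X (p i).
Variables (m : nat) (deg_dvd : forall i, (deg (p i) %| m)%N) (i0 : 'I_s).
Local Notation b := #|F|.
Local Notation A_ := (index_poly phi).
Local Notation num i B := (coord_num phiV (p i) (y i) m B).
Local Notation reindex_box := (sum_box_index phiK phiVK phi0 p_nonconst p_coprime
  y_indep p_coprimeX deg_dvd).

Let b_gt1 : (1 < b)%N := card_field_gt1 F.

Lemma sum_coord_num (h : nat -> R) U M i :
  b%:R ^+ m * (\sum_(k < b ^ (s * m)) h (num i (U + 'X^M * A_ k))) =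
  (\sum_(x < b ^ m) h x) * b%:R ^+ (s * m).
Proof.
have := sum_ffun_eval i (fun x : 'I_(b ^ m) => h x).
rewrite !card_ord -expnM [(m * s)%N]mulnC !natrX => <-; congr (_ * _).
rewrite -(reindex_box (fun T => h (T i)) U M).
by apply: eq_bigr => k _; rewrite ffunE.
Qed.

Section OneLevel.
Variables (G : 'I_s -> nat) (G_le : forall i, (G i <= b ^ m)%N).
Variables (M : nat -> nat) (M_gap : forall t, (M t + 3 <= M t.+1)%N).
Variables (t T : nat) (tT : (t < T)%N).
Variables (l : {poly F} -> F) (r : nat) (kappa : nat -> F).
Hypothesis lD : forall A B : {poly F}, l (A + B) = l A + l B.
Hypothesis lZ : forall a (A : {poly F}), l (a *: A) = a * l A.
Hypothesis l_small : forall A : {poly F}, (size A <= M t)%N -> l A = 0.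
Hypothesis l_Xn : l 'X^(M t) != 0.
Hypothesis l_num : forall A, l A = level_value phi r.+1 kappa (num i0 A).
Hypothesis G_active : (b ^ r <= G i0 %% b ^ r.+2 <= b * b ^ r.+1 - b ^ r)%N.

(** As l (U + B) - l U = l B and [l] reads only the first m digits of coordinate i0,
    equidistribution turns the sum over k into one over all digit patterns, which factors over the
    coordinates. *)
Lemma sum_test_box (theta : F -> R) U Mtop :
  \sum_(k < b ^ (s * m)) theta (l ('X^Mtop * A_ k)) *
    [forall i, (num i (U + 'X^Mtop * A_ k) < G i)%N]%:R =
  (\prod_(i | i != i0) (G i)%:R) *
  \sum_(x < G i0) theta (level_value phi r.+1 kappa x - l U).
Proof.
pose g i (x : 'I_(b ^ m)) : R := (x < G i)%N%:R.
pose psi (T : {ffun 'I_s -> 'I_(b ^ m)}) :=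
  (theta (level_value phi r.+1 kappa (T i0) - l U) * g i0 (T i0)) *
  \prod_(i | i != i0) g i (T i).
transitivity (\sum_T psi T).
  rewrite -(reindex_box psi U Mtop); apply: eq_bigr => k _.
  rewrite /psi -mulrA /g !ffunE /= -l_num lD [l U + _]addrC addrK; congr (_ * _).
  rewrite -prod_nat_forall [LHS](bigD1 i0) //=; congr (_ * _).
  by apply: eq_bigr => i _; rewrite ffunE.
rewrite (sum_ffun_coord i0 (fun x : 'I_(b ^ m) =>
  theta (level_value phi r.+1 kappa x - l U) * g i0 x)).
rewrite mulrC; congr (_ * _); first by apply: eq_bigr => i _; exact: sum_ltn.
under eq_bigr do rewrite mulrC.
exact: (sum_mul_ltn (fun x => theta (level_value phi r.+1 kappa x - l U))).
Qed.

Lemma level_correlation Mtop : exists2 theta : F -> R,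
  \sum_v theta v = 0 /\ (forall v, `|theta v| <= 1) &
  (\prod_(i | i != i0) (G i)%:R) * b%:R ^+ r * b%:R ^+ M t / 2 <=
  \sum_(k < b ^ (s * m)) theta (l ('X^Mtop * A_ k)) *
    \sum_(n < sparse_num F M T)
      [forall i, (num i (A_ n + 'X^Mtop * A_ k) < G i)%N]%:R.
Proof.
(* [W] comes first, so that [theta] can be the gap test shifted by [l W]; this makes [g (l W)]
   large. *)
have [W hW] := sum_sparse_level phiK phiVK phi0 M_gap tT.
have [th0 th1 thB thG] := gap_testP phiK phiVK R kappa G_active (l W).
set theta := gap_test _ _ _ _ _ _ in th0 th1 thB thG.
exists theta => //.
set P := \prod_(i | _) _.
have P0 : 0 <= P by apply: prodr_ge0.
pose g (u : F) := P * \sum_(x < G i0) theta (level_value phi r.+1 kappa x - u).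
have -> : \sum_(k < b ^ (s * m)) theta (l ('X^Mtop * A_ k)) *
    \sum_(n < sparse_num F M T) [forall i, (num i (A_ n + 'X^Mtop * A_ k) < G i)%N]%:R =
    \sum_(n < sparse_num F M T) g (l (A_ n)).
  under eq_bigr do rewrite mulr_sumr.
  by rewrite exchange_big; apply: eq_bigr => n _; rewrite sum_test_box.
have g_sum0 : \sum_u g u = 0.
  rewrite -mulr_sumr exchange_big big1 ?mulr0 //= => x _.
  rewrite -[RHS]th0 [RHS](reindex (fun u => level_value phi r.+1 kappa x - u)) //.
  by exists (fun u => level_value phi r.+1 kappa x - u) => u _; rewrite subKr.
have [h ->] := hW _ l g lD lZ l_small l_Xn g_sum0.
have bX n : 0 < b%:R ^+ n :> R by rewrite exprn_gt0 // ltr0n ltnW.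
have g_le u : `|g u| <= P * b%:R ^+ r.+1.
  by rewrite normrM ger0_norm // ler_wpM2l.
have g_ge : P * b%:R ^+ r <= g (l W) by rewrite ler_wpM2l.
(* Each term is at most P b^(r+1), and 2b times their number is at most b^(M t), so together they
   stay within half of the main term. *)
have small : `|\sum_(n < sparse_num F M t) g (h n)| <= P * b%:R ^+ r * (b%:R ^+ M t / 2).
  apply: le_trans (ler_norm_sum _ _ _) _.
  apply: (@le_trans _ _ (\sum_(n < sparse_num F M t) P * b%:R ^+ r.+1)); first exact: ler_sum.
  rewrite sumr_const card_ord -[leLHS]mulr_natr.
  have -> : P * b%:R ^+ r.+1 * (sparse_num F M t)%:R =
            P * b%:R ^+ r * (b%:R * (sparse_num F M t)%:R) by rewrite exprSr; ring.
  apply: ler_wpM2l; first by rewrite mulr_ge0 // ltW.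
  rewrite ler_pdivlMr // mulrC mulrA -natrM -natrX -natrM ler_nat.
  exact: sparse_num_bound.
have main : P * b%:R ^+ r * b%:R ^+ M t <= g (l W) *+ b ^ M t.
  by rewrite -[leRHS]mulr_natr natrX ler_wpM2r // ltW.
move: small main; rewrite ler_norml => /andP[small _] main.
by move: small main; rewrite !mulrA; lra.
Qed.

End OneLevel.
End Correlation.

(* Cauchy-Schwarz for the correlation of a bounded function with a sum of
   T pairwise orthogonal functions bounded by 1 *)
Lemma correlation_bound (R : realType) (K T : nat) (f : 'I_K -> R)
    (th : nat -> 'I_K -> R) (c C : R) :
  (0 < K)%N -> 0 < c ->
  (forall k, `|f k| <= C) -> (forall t k, (t < T)%N -> `|th t k| <= 1) ->
  (forall t t', (t < t')%N -> (t' < T)%N -> \sum_k th t k * th t' k = 0) ->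
  T%:R * c * K%:R <= \sum_k (\sum_(t < T) th t k) * f k ->
  T%:R * c ^+ 2 <= C ^+ 2.
Proof.
move=> K0 c0 fC th1 orth lo.
have K0' : 0 < K%:R :> R by rewrite ltr0n.
(* By orthogonality only the diagonal terms survive, each at most K. *)
have sq : \sum_k (\sum_(t < T) th t k) ^+ 2 <= T%:R * K%:R.
  under eq_bigr do rewrite expr2 mulr_suml.
  rewrite exchange_big /=.
  apply: (@le_trans _ _ (\sum_(t < T) K%:R)); last by rewrite sumr_const card_ord mulr_natl.
  apply: ler_sum => t _; under eq_bigr do rewrite mulr_sumr.
  rewrite exchange_big (bigD1 t) //= [X in _ + X]big1 ?addr0 => [|t' ne].
    apply: (@le_trans _ _ (\sum_(k < K) 1)); last by rewrite sumr_const card_ord.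
        apply: ler_sum => k _; rewrite -expr2 -real_normK ?num_real //.
    by rewrite expr_le1 // th1.
  have [tt|tt|/val_inj e] := ltngtP t t'; last by rewrite e eqxx in ne.
    exact: orth.
  by rewrite -[RHS](orth t' t) //; apply: eq_bigr => k _; rewrite mulrC.
(* Writing S for the sum of the [th t], (f - c S)^2 >= 0 gives 2 c S f <= f^2 + c^2 S^2. *)
have : 2 * c * (\sum_k (\sum_(t < T) th t k) * f k) <=
       \sum_k (C ^+ 2 + c ^+ 2 * (\sum_(t < T) th t k) ^+ 2).
  rewrite mulr_sumr; apply: ler_sum => k _.
  have : f k ^+ 2 <= C ^+ 2.
    rewrite -real_normK ?num_real //; apply: lerXn2r; rewrite ?nnegrE //.
    exact: le_trans (fC k).
  have := sqr_ge0 (f k - c * \sum_(t < T) th t k).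
  move: (\sum_(t < T) _) => z; nra.
rewrite big_split /= sumr_const card_ord -mulr_sumr -[X in _ <= X + _]mulr_natr => hi.
have : 2 * c * (T%:R * c * K%:R) <= C ^+ 2 * K%:R + c ^+ 2 * (T%:R * K%:R).
  apply: le_trans (le_trans _ hi) _; first by rewrite ler_wpM2l // mulr_ge0 // ltW.
  by rewrite lerD2l ler_wpM2l // sqr_ge0.
rewrite -(ler_pM2r K0'); nra.
Qed.

(** * Unbounded discrepancy for non-terminating digits *)

Section Unbounded.
Variables (R : realType) (F : finFieldType).
Variables (phi : 'I_#|F| -> F) (phiV : F -> 'I_#|F|).
Hypothesis phiK : cancel phi phiV.
Hypothesis phiVK : cancel phiV phi.
Hypothesis phi0 : forall a : 'I_#|F|, val a = 0%N -> phi a = 0.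
Variables (s : nat) (p : 'I_s -> {poly F}) (y : 'I_s -> nat -> nat -> {poly F}).
Hypothesis p_nonconst : forall i, (1 <= deg (p i))%N.
Hypothesis p_coprime : forall i i', i != i' -> coprimep (p i) (p i').
Hypothesis y_indep : forall i j, (1 <= j)%N -> lin_indep_mod (p i) (y i j).
Hypothesis p_coprimeX : forall i, coprimep 'X (p i).
Variable gamma : 'I_s -> R.
Hypothesis gamma01 : forall i, 0 < gamma i < 1.
Variable d : 'I_s -> nat -> nat.
Local Notation b := #|F|.
Hypothesis d_lt : forall i j, (1 <= j)%N -> (d i j < b)%N.
Hypothesis gamma_sum : forall i, gamma i = badic_sum R b (d i).
Local Notation x_ := (niederreiter_sequence R phi phiV p y).
Local Notation A_ := (index_poly phi).
Local Notation num i m B := (coord_num phiV (p i) (y i) m B).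
Local Notation in_box n := (in_box phi phiV p y gamma n).

Let b_gt1 : (1 < b)%N := card_field_gt1 F.

Let bX_gt0 n : 0 < b%:R ^+ n :> R.
Proof. by rewrite exprn_gt0 // ltr0n ltnW. Qed.

Definition in_box_digits (m : nat) (B : {poly F}) : bool :=
  [forall i, (num i m B < digits_num b (d i) m)%N].

(** The first m digits decide membership unless, in some coordinate, their integer equals that of
    gamma_i or one less. Either value is taken by a proportion at most b^-m of the k. *)
Lemma in_box_approx m Mtop n : (forall i, (deg (p i) %| m)%N) -> (n < b ^ Mtop)%N ->
  b%:R ^+ m * (\sum_(k < b ^ (s * m))
    `|(in_box (k * b ^ Mtop + n))%:R - (in_box_digits m (A_ n + 'X^Mtop * A_ k))%:R|)
  <= (2 * s)%:R * b%:R ^+ (s * m) :> R.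
Proof.
move=> em nM.
pose E i (x : nat) := (x == digits_num b (d i) m) || (x == (digits_num b (d i) m).-1).
have diff k : `|(in_box (k * b ^ Mtop + n))%:R -
      (in_box_digits m (A_ n + 'X^Mtop * A_ k))%:R| <=
    \sum_i (E i (num i m (A_ n + 'X^Mtop * A_ k)))%:R :> R.
  apply: dist_forall_le => i; rewrite negb_or => /andP[/eqP ne1 /eqP ne2].
  have := niederreiter_coord_bounds R phi phiV y p_nonconst i m (k * b ^ Mtop + n).
  have := badic_sum_bounds R b_gt1 (@d_lt i) m.
  rewrite -gamma_sum index_poly_block // [X in coord_num _ _ _ _ X]addrC.
  move: (num i m _) (digits_num _ _ _) ne1 ne2 => u v ne1 ne2.
  rewrite !natr1 => /andP[g1 g2] /andP[x1 x2].
  have [uv|vu] := ltnP u v.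
    rewrite -(ltr_pM2l (bX_gt0 m)) (le_lt_trans x2) // (lt_le_trans _ g1) //.
    by rewrite ltr_nat; lia.
  apply/negbTE; rewrite -leNgt -(ler_pM2l (bX_gt0 m)) (le_trans g2) // (le_trans _ x1) //.
  by rewrite ler_nat; lia.
have Ele i : \sum_(x < b ^ m) (E i x)%:R <= 2 :> R.
  have one v : \sum_(x < b ^ m) (x == v :> nat)%:R <= 1 :> R.
    exact: (sum_eq_inj_le1 R (f := id)).
  have := one (digits_num b (d i) m); have := one (digits_num b (d i) m).-1.
  suff : \sum_(x < b ^ m) (E i x)%:R <= \sum_(x < b ^ m)
     ((x == digits_num b (d i) m :> nat)%:R + (x == (digits_num b (d i) m).-1 :> nat)%:R) :> R.
    by rewrite big_split /=; lra.
  apply: ler_sum => x _; rewrite /E -natrD ler_nat.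
  by case: (_ == _); case: (_ == _).
apply: (@le_trans _ _ (b%:R ^+ m * \sum_(k < b ^ (s * m)) \sum_i
    (E i (num i m (A_ n + 'X^Mtop * A_ k)))%:R)).
  by rewrite ler_wpM2l ?(ltW (bX_gt0 m)) //; apply: ler_sum => k _; exact: diff.
rewrite exchange_big mulr_sumr /=.
under eq_bigr do rewrite (sum_coord_num phiK phiVK phi0 p_nonconst p_coprime y_indep
  p_coprimeX em (fun x => (E _ x)%:R)).
apply: (@le_trans _ _ (\sum_(i < s) 2 * b%:R ^+ (s * m))).
  by apply: ler_sum => i _; rewrite ler_wpM2r // ltW.
by rewrite sumr_const card_ord -[leLHS]mulr_natr natrM; lra.
Qed.

Lemma nonzero_digit i : exists2 j, (1 <= j)%N & (0 < d i j)%N.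
Proof.
apply: contrapT => nz; have /andP[g0 _] := gamma01 i.
suff : gamma i = 0 by move=> e; rewrite e ltxx in g0.
rewrite gamma_sum /badic_sum (_ : (fun m => _) = fun=> 0) ?lim_cst //.
apply/funext => m; rewrite big_nat big1 // => j /andP[j1 _].
have -> : d i j = 0%N by apply/eqP; rewrite -leqn0 leqNgt; apply/negP => h; apply: nz; exists j.
by rewrite mul0r.
Qed.

Variable i0 : 'I_s.
Local Notation e := (deg (p i0)).

Definition level_function (w : nat -> F) (J : nat) (B : {poly F}) : F :=
  row_form (p i0) (y i0) J B + \sum_(j < J.-1) w j * row_form (p i0) (y i0) j.+1 B.

Lemma level_functionD w J B B' :
  level_function w J (B + B') = level_function w J B + level_function w J B'.
Proof.
rewrite /level_function row_formD // addrACA -big_split; congr (_ + _).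
by apply: eq_bigr => j _; rewrite row_formD // mulrDr.
Qed.

Lemma level_functionZ w J a B : level_function w J (a *: B) = a * level_function w J B.
Proof.
rewrite /level_function row_formZ // mulrDr mulr_sumr; congr (_ + _).
by apply: eq_bigr => j _; rewrite row_formZ // mulrCA.
Qed.

Definition level_data (x : (nat * nat) * (nat -> F)) : Prop :=
  let J := x.1.1 in let M := x.1.2 in
  [/\ (1 <= J)%N /\ active b (d i0) J,
      forall B : {poly F}, (size B <= M)%N -> level_function x.2 J B = 0,
      level_function x.2 J 'X^M != 0,
      (J <= M + e)%N & (M < J + e)%N].

Lemma sparse_levels : (forall K, exists2 J, (K <= J)%N & active b (d i0) J) ->
  exists (J M : nat -> nat) (w : nat -> nat -> F),
  [/\ forall t, level_data (J t, M t, w t), forall t, (M t + 3 <= M t.+1)%N &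
      forall t t', (t < t')%N -> (J t < J t')%N].
Proof.
move=> act.
have /choice[f hf] (K : nat) : exists x, (K <= x.1.1)%N /\ level_data x.
  have [J KJ aJ] := act (maxn K 1); have J1 : (1 <= J)%N by lia.
  have [M [w [h1 h2 h3 h4]]] := level_form (p_nonconst i0) (@y_indep i0) J1.
  by exists (J, M, w); split; [rewrite /=; lia | split].
(* Since M and J differ by at most e, spacing the J by 2e + 3 spaces the M by at least 3. *)
pose q t := iter t (fun x => f (x.1.1 + 2 * e + 3)%N) (f 0%N).
have hq t : level_data (q t) by case: t => [|t] /=; apply: (hf _).2.
have qS t : ((q t).1.1 + 2 * e + 3 <= (q t.+1).1.1)%N by exact: (hf _).1.
exists (fun t => (q t).1.1), (fun t => (q t).1.2), (fun t => (q t).2); split.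
- by move=> t; have := hq t; case: (q t) => -[].
- move=> t; have [_ _ _ _ h1] := hq t; have [_ _ _ h2 _] := hq t.+1.
  by have := qS t; move: h1 h2; lia.
- apply: (homo_ltn (r := fun x z => (x < z)%N)) => [x u z|t]; first exact: ltn_trans.
  by have := qS t; lia.
Qed.

Lemma active_not_bounded :
  (forall K, exists2 J, (K <= J)%N & active b (d i0) J) ->
  ~ bounded_remainder_set x_ (box gamma).
Proof.
move=> /sparse_levels[J [M [w [lev M_gap J_homo]]]] [C hC].
have discrC N : `|discrepancy x_ (box gamma) N| <= `|C|.
  case: N => [|N]; first by rewrite /discrepancy big_ord0 normr0.
  by rewrite (le_trans _ (ler_norm C)) //; apply: hC; exists N.+1.
have /choice[m1 hm1] (i : 'I_s) : exists j, (1 <= j)%N /\ (0 < d i j)%N.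
  by have [j] := nonzero_digit i; exists j.
(* Lower bound for the correlation per index k: the truncation of gamma_i is at least b^-m1(i) for i
   other than i0, M and J differ by at most e, and 1/2 allows for the lower levels. It depends on
   neither [T] nor [m]. *)
pose c : R := (\prod_(i | i != i0) (b%:R ^+ m1 i)^-1) / b%:R ^+ e.+1 / 2.
have c_gt0 : 0 < c.
  by rewrite !divr_gt0 // prodr_gt0 // => i _; rewrite invr_gt0.
have c2_gt0 : 0 < c / 2 by rewrite divr_gt0.
(* Enough levels for Bessel's inequality with constant c/2 to contradict the bound 2|C|; [N], [Z]
   and [m] are chosen after [T]. *)
pose T := Num.bound ((2 * `|C|) ^+ 2 / (c / 2) ^+ 2).
have T_big : (2 * `|C|) ^+ 2 < T%:R * (c / 2) ^+ 2.
  rewrite -ltr_pdivrMr ?exprn_gt0 //.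
  exact: archi_boundP (divr_ge0 (sqr_ge0 _) (sqr_ge0 _)).
(* Once b^m >= [Z], replacing the box by patterns of m digits costs at most c/2 per level and index
   k on average. *)
set N := sparse_num F M T; pose Z := Num.bound ((N * (2 * s))%:R / (c / 2)).
have Z_big : (N * (2 * s))%:R <= Z%:R * (c / 2) :> R.
  rewrite -ler_pdivrMr //; apply: ltW; apply: archi_boundP.
  by rewrite divr_ge0 // ltW.
have [m m_ge em] := common_multiple (J T + \sum_i m1 i + Z) p_nonconst.
have Jm : (J T <= m)%N by lia.
have m1m i : (m1 i <= m)%N.
  by rewrite (leq_trans _ m_ge) // (bigD1 i) //=; lia.
have Zm : Z%:R <= b%:R ^+ m :> R.
  rewrite -natrX ler_nat (leq_trans _ (ltnW (ltn_expl m b_gt1))) //; lia.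
pose G i := digits_num b (d i) m.
have G_le i : (G i <= b ^ m)%N by rewrite ltnW // digits_num_lt // => j; exact: d_lt.
pose l t := level_function (w t) (J t).
pose kappa t := lower_part phi (w t) (J t).
have Jt t : (t < T)%N -> (1 <= J t)%N /\ (J t < m)%N.
  move=> tT; have [[J1 _] _ _ _ _] := lev t; split=> //.
  exact: leq_trans (J_homo _ _ tT) Jm.
have l_num t B : (t < T)%N ->
    l t B = level_value phi (m - J t).-1.+1 (kappa t) (num i0 m B).
  move=> tT; have [J1 Jlt] := Jt t tT.
  by rewrite prednK ?subn_gt0 // -level_valueE // J1 ltnW.
have b_s k : b%:R ^+ (s * k) = \prod_(i < s) b%:R ^+ k :> R.
  by rewrite prodr_const card_ord -exprM mulnC.
pose Mtop := M T; pose D := (b ^ (s * m))%N.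
have D_gt0 : (0 < D)%N by rewrite expn_gt0 ltnW.
have N_lt : (N < b ^ Mtop)%N by exact: sparse_num_lt.
pose f0 (k n : nat) : R := (in_box_digits m (A_ n + 'X^Mtop * A_ k))%:R.
have /choice[th hth] (t : nat) : exists th : F -> R, (t < T)%N ->
    [/\ \sum_v th v = 0, forall v, `|th v| <= 1 &
        c * D%:R <= \sum_(k < D) th (l t ('X^Mtop * A_ k)) * \sum_(n < N) f0 k n].
  have [tT|tT] := ltnP t T; last by exists (fun=> 0).
  have [[J1 aJ] ls lX JM MJ] := lev t; have [_ Jlt] := Jt t tT.
  have act : (b ^ (m - J t).-1 <= G i0 %% b ^ (m - J t).-1.+2 <=
              b * b ^ (m - J t).-1.+1 - b ^ (m - J t).-1)%N.
    have := active_mod b_gt1 (@d_lt i0) (m - J t).-1 J1 aJ.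
    by rewrite (_ : (J t + (m - J t).-1.+1 = m)%N) //; lia.
  have [th [th0 th1] lo] := level_correlation R phiK phiVK phi0 p_nonconst p_coprime
    y_indep p_coprimeX em G_le M_gap tT (@level_functionD (w t) (J t))
    (@level_functionZ (w t) (J t)) ls lX (fun B => l_num t B tT) act Mtop.
  exists th => _; split=> //; apply: le_trans lo.
  have -> : D%:R = b%:R ^+ m * \prod_(i | i != i0) b%:R ^+ m :> R.
    by rewrite natrX b_s (bigD1 i0).
  have PG : \prod_(i | i != i0) (b%:R ^+ m1 i)^-1 * \prod_(i | i != i0) b%:R ^+ m <=
            \prod_(i | i != i0) (G i)%:R :> R.
    rewrite -big_split; apply: ler_prod => i _ /=; rewrite mulr_ge0 ?invr_ge0 ?(ltW (bX_gt0 _)) //=.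
    have [j1 dj] := hm1 i.
    rewrite -{1}(subnK (m1m i)) exprD mulrCA mulVf ?gt_eqF // mulr1 -natrX ler_nat.
    by apply: digits_num_ge => //; [exact: (@d_lt i) | rewrite j1 m1m].
  (* The exponents compare because J <= M + e; the extra 1 makes up for the predecessor. *)
  have bJ : b%:R ^+ m / b%:R ^+ e.+1 <= b%:R ^+ (m - J t).-1 * b%:R ^+ M t :> R.
    rewrite (ler_pdivrMr _ _ (bX_gt0 _)) -!exprD; apply: ler_weXn2l.
      by rewrite ler1n ltnW.
    by move: JM Jlt => /=; clear; lia.
  rewrite /c; move: PG bJ; set P1 := \prod_(i | _) _; set P2 := \prod_(i | _) _.
  set P3 := \prod_(i | _) _ => PG bJ.
  have P12 : 0 <= P1 * P2.
    by rewrite mulr_ge0 // prodr_ge0 // => i _; rewrite ?invr_ge0 (ltW (bX_gt0 _)).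
  have bm0 : 0 <= b%:R ^+ m / b%:R ^+ e.+1 :> R by rewrite ltW // divr_gt0.
  have := ler_pM P12 bm0 PG bJ.
  rewrite -!mulrA ![_ / 2]mulrC; lra.
pose theta t (k : 'I_D) := th t (l t ('X^Mtop * A_ k)).
have th_sum (h : nat -> R) : \sum_(x < b ^ m) h x = 0 ->
    \sum_(k < D) h (num i0 m ('X^Mtop * A_ k)) = 0.
  move=> h0; apply: (mulfI (lt0r_neq0 (bX_gt0 m))); rewrite mulr0.
  have := sum_coord_num phiK phiVK phi0 p_nonconst p_coprime y_indep p_coprimeX em
    h 0 Mtop i0.
  rewrite h0 mul0r => hE; rewrite -[RHS]hE; congr (_ * _).
  by apply: eq_bigr => k _; rewrite add0r.
have th_mean t : (t < T)%N -> \sum_k theta t k = 0.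
  move=> tT; have [th0 _ _] := hth t tT; have [J1 Jlt] := Jt t tT.
  pose h x := th t (level_value phi (m - J t).-1.+1 (kappa t) x).
  have h0 : \sum_(x < b ^ m) h x = 0.
    by apply: (sum_level_value0 phiK phiVK) => //; lia.
  by rewrite -[RHS](th_sum h h0); apply: eq_bigr => k _; rewrite /theta l_num.
have th_orth t t' : (t < t')%N -> (t' < T)%N -> \sum_k theta t k * theta t' k = 0.
  move=> tt' t'T; have tT := ltn_trans tt' t'T.
  have [th0 _ _] := hth t' t'T; have [J1 Jlt] := Jt t' t'T.
  have [J1' Jlt'] := Jt t tT; have JJ := J_homo _ _ tt'.
  pose h x := th t (level_value phi (m - J t).-1.+1 (kappa t) x) *
              th t' (level_value phi (m - J t').-1.+1 (kappa t') x).
  have h0 : \sum_(x < b ^ m) h x = 0.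
    by apply: (level_values_orthogonal phiK phiVK) => //; lia.
  by rewrite -[RHS](th_sum h h0); apply: eq_bigr => k _; rewrite /theta !l_num.
pose lam := \prod_i gamma i.
(* The discrepancy over the N indices from k b^Mtop on, a difference of two values bounded by
   |C|. *)
pose f (k : 'I_D) : R := \sum_(n < N) ((in_box (k * b ^ Mtop + n))%:R - lam).
have f_le k : `|f k| <= 2 * `|C|.
  have -> : f k = discrepancy x_ (box gamma) (k * b ^ Mtop + N) -
                  discrepancy x_ (box gamma) (k * b ^ Mtop).
    rewrite !(discrepancy_box phi phiV y p_nonconst gamma01).
    by rewrite big_split_ord /= addrAC subrr add0r.
  by apply: le_trans (ler_normB _ _) _; rewrite mulr_natl mulr2n lerD.
pose Phi k := \sum_(t < T) theta t k.
have theta_le t k : (t < T)%N -> `|theta t k| <= 1.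
  by move=> tT; have [_ th1 _] := hth t tT; exact: th1.
have Phi_le k : `|Phi k| <= T%:R.
  apply: le_trans (ler_norm_sum _ _ _) _.
  apply: (@le_trans _ _ (\sum_(t < T) 1)); last by rewrite sumr_const card_ord.
  by apply: ler_sum => t _; exact: theta_le.
have Phi_mean : \sum_k Phi k = 0.
  by rewrite exchange_big big1 // => t _; exact: th_mean.
have main : T%:R * (c * D%:R) <= \sum_k Phi k * \sum_(n < N) f0 k n.
  under eq_bigr do rewrite mulr_suml.
  rewrite exchange_big /= mulr_natl -[in leLHS](card_ord T) -sumr_const.
  by apply: ler_sum => t _; have [] := hth t (ltn_ord t).
pose Err (k : 'I_D) : R := \sum_(n < N) ((in_box (k * b ^ Mtop + n))%:R - f0 k n).
have err : `|\sum_k Phi k * Err k| <= T%:R * (c / 2) * D%:R.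
  pose del (k : 'I_D) (n : nat) : R := `|(in_box (k * b ^ Mtop + n))%:R - f0 k n|.
  apply: (@le_trans _ _ (T%:R * \sum_(n < N) \sum_k del k n)).
    rewrite exchange_big mulr_sumr; apply: le_trans (ler_norm_sum _ _ _) _.
    apply: ler_sum => k _; rewrite normrM; apply: ler_pM => //.
    exact: ler_norm_sum.
  rewrite -mulrA; apply: ler_wpM2l => //.
  rewrite -(ler_pM2l (bX_gt0 m)) mulr_sumr.
  apply: (@le_trans _ _ (\sum_(n < N) (2 * s)%:R * b%:R ^+ (s * m))).
    apply: ler_sum => n _; apply: in_box_approx => //.
    exact: ltn_trans (ltn_ord n) N_lt.
  rewrite sumr_const card_ord -[leLHS]mulr_natl mulrA -natrM -natrX mulrA.
  apply: ler_wpM2r => //; apply: le_trans Z_big _.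
  by apply: ler_wpM2r => //; exact: ltW.
(* The constant [lam] drops out since [Phi] has mean zero, and [Err] takes at most half of the main
   term. *)
have lo : T%:R * (c / 2) * D%:R <= \sum_k Phi k * f k.
  have fE k : Phi k * f k = Phi k * (\sum_(n < N) f0 k n) + Phi k * Err k - Phi k * (lam *+ N).
    rewrite -mulrDr -mulrBr; congr (_ * _); rewrite /f /Err !sumrB sumr_const card_ord.
    by congr (_ - _); rewrite [RHS]addrC subrK.
  under eq_bigr do rewrite fE.
  rewrite sumrB big_split /= -[\sum_(k < D) _ * (lam *+ N)]mulr_suml Phi_mean mul0r subr0.
  move: main err; rewrite ler_norml => main /andP[err _].
  by move: main err; rewrite !mulrA; lra.
have := correlation_bound D_gt0 c2_gt0 f_le theta_le th_orth lo.
by rewrite leNgt T_big.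
Qed.

End Unbounded.

(** * Terminating digit sequences and the equivalences *)

Lemma badic_sum_finite (R : realType) b (d : nat -> nat) K :
  (forall j, (K <= j)%N -> d j = 0%N) ->
  badic_sum R b d = \sum_(1 <= j < K.+1) ((d j)%:R / b%:R ^+ j).
Proof.
move=> d0; apply: lim_near_cst => //.
apply: filterS (nbhs_infty_ge K) => m Km.
rewrite (big_cat_nat (n := K.+1)) //= [X in _ + X]big_nat [X in _ + X]big1 ?addr0 //.
move=> j /andP[Kj _].
by rewrite d0 ?mul0r // ltnW.
Qed.

Lemma ereal_sup_nat_lt_pinfty (R : realType) (P : pred nat) :
  (ereal_sup [set j%:R%:E | j in [set j | P j]] < +oo :> \bar R)%E <->
  exists K, forall j, (K <= j)%N -> ~~ P j.
Proof.
split=> [|[K hK]].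
  set S := ereal_sup _; move=> Soo.
  have le j : P j -> (j%:R%:E <= S)%E by move=> Pj; apply: ereal_sup_ubound; exists j.
  case: S Soo le => // [r _|_] le; last first.
    (* A supremum -oo means that no j satisfies [P]. *)
    by exists 0%N => j _; apply/negP => /le.
  exists (Num.bound `|r|) => j rj; apply/negP => /le; rewrite lee_fin leNgt.
  rewrite (le_lt_trans (ler_norm r)) //; apply: lt_le_trans (archi_boundP _) _ => //.
  by rewrite ler_nat.
apply: (@le_lt_trans _ _ K%:R%:E); last exact: ltry.
apply: ge_ereal_sup => _ [j Pj <-]; rewrite lee_fin ler_nat ltnW // ltnNge.
by apply/negP => /hK; rewrite Pj.
Qed.

Lemma max_nonzero_digit_lt_pinfty (R : realType) s (d : 'I_s -> nat -> nat) :
  (max_nonzero_digit R d < +oo)%E <->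
  forall i, exists K, forall j, (K <= j)%N -> d i j = 0%N.
Proof.
split=> [|h].
  move=> /bigmax_ltP[_ lt] i; have /ereal_sup_nat_lt_pinfty[K hK] := lt i isT.
  exists (maxn K 1) => j; rewrite geq_max => /andP[Kj j1].
  by have := hK j Kj; rewrite j1 /= negbK => /eqP.
apply/bigmax_ltP; split=> // i _; apply/ereal_sup_nat_lt_pinfty.
by have [K hK] := h i; exists K => j Kj; rewrite hK // andbF.
Qed.

Theorem theorem1 (R : realType) (F : finFieldType)
    (phi : 'I_#|F| -> F) (phiV : F -> 'I_#|F|)
    (phiK : cancel phi phiV) (phiVK : cancel phiV phi)
    (phi0 : forall a : 'I_#|F|, val a = 0%N -> phi a = 0)
    (s : nat) (s_ge1 : (1 <= s)%N)
    (p : 'I_s -> {poly F}) (y : 'I_s -> nat -> nat -> {poly F})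
    (p_nonconst : forall i, (1 <= deg (p i))%N)
    (p_coprime : forall i i', i != i' -> coprimep (p i) (p i'))
    (y_indep : forall i j, (1 <= j)%N -> lin_indep_mod (p i) (y i j))
    (p_coprimeX : forall i, coprimep 'X (p i))
    (gamma : 'I_s -> R) (gamma01 : forall i, 0 < gamma i < 1)
    (d : 'I_s -> nat -> nat)
    (gammaE : forall i, badic_expansion #|F| (gamma i) (d i)) :
  (bounded_remainder_set (niederreiter_sequence R phi phiV p y) (box gamma) <->
     (max_nonzero_digit R d < +oo)%E) /\
  (bounded_remainder_set (niederreiter_sequence R phi phiV p y) (box gamma) <->
     forall i, has_finite_badic_expansion #|F| (gamma i)).
Proof.
have d_lt i j : (1 <= j)%N -> (d i j < #|F|)%N by have [h _ _] := gammaE i; exact: h.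
have gamma_sum i : gamma i = badic_sum R #|F| (d i) by have [] := gammaE i.
have bounded_digits :
    bounded_remainder_set (niederreiter_sequence R phi phiV p y) (box gamma) ->
    forall i, exists K, forall j, (K <= j)%N -> d i j = 0%N.
  move=> bnd i; apply: contrapT => inf.
  apply: (active_not_bounded phiK phiVK phi0 p_nonconst p_coprime y_indep p_coprimeX
            gamma01 d_lt gamma_sum _ bnd (i0 := i)).
  (* The digits do not terminate, and the normalisation of the expansion excludes a tail of digits b
     - 1, so active places occur arbitrarily far out. *)
  apply: active_unbounded => //; [exact: card_field_gt1 | exact: (@d_lt i) | |].
    move=> K; apply: contrapT => nz; apply: inf; exists K => j Kj.
    by apply/eqP; apply: contraT => /eqP dj; case: nz; exists j.
  by have [_ _] := gammaE i.
have digits_finite : (forall i, exists K, forall j, (K <= j)%N -> d i j = 0%N) ->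
    forall i, has_finite_badic_expansion #|F| (gamma i).
  move=> h i; have [K hK] := h i; exists K, (d i); split; first exact: (@d_lt i).
  by rewrite gamma_sum (badic_sum_finite _ _ hK).
have finite_bounded : (forall i, has_finite_badic_expansion #|F| (gamma i)) ->
    bounded_remainder_set (niederreiter_sequence R phi phiV p y) (box gamma).
  exact: finite_expansion_bounded.
split; split=> [bnd|h].
- exact/max_nonzero_digit_lt_pinfty/bounded_digits.
- by apply/finite_bounded/digits_finite/(max_nonzero_digit_lt_pinfty R).
- exact/digits_finite/bounded_digits.
- exact: finite_bounded.
Qed.
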